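(* Let $\psi:\mathbb{N}\to\mathbb{R}$ be an additive arithmetic function, not identically zero, such that $c_1<\infty$ and $c_2<\infty$. Let $n\ge 27$ be an integer such that $\sigma_n>0$ and $\sigma_n^2\ge 3(c_1^2+c_2^2)$. Let $H_n$ be a random variable with $\mathbb{P}[H_n=k]=\frac{1}{L_nk}$ for $k\in\{1,\dots,n\}$, where $L_n=\sum_{j=1}^n\frac1j$, and let $N$ be a standard Gaussian random variable. Then $$d_{\mathrm K}\Big(\frac{\psi(H_n)-\mu_n}{\sigma_n},N\Big)\le \frac{\gamma_1}{\sigma_n}+\frac{\gamma_2}{\sigma_n^2}\qquad\text{and}\qquad d_1\Big(\frac{\psi(H_n)-\mu_n}{\sigma_n},N\Big)\le\frac{\gamma_3}{\sigma_n},$$ where $$\gamma_1=32c_1+33c_2,\qquad \gamma_2=363c_1^2+58c_1c_2,\qquad \gamma_3=105c_1+2c_2.$$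
   Context: $\mathbb{N}=\{1,2,\dots\}$, $\mathbb{N}_0=\mathbb{N}\cup\{0\}$. $\mathcal{P}$ is the set of primes and $\mathcal{P}_n=\mathcal{P}\cap\{1,\dots,n\}$. A function $\psi:\mathbb{N}\to\mathbb{R}$ is additive if $\psi(jk)=\psi(j)+\psi(k)$ whenever $j,k$ are co-prime. $(\xi_p)_{p\in\mathcal{P}}$ are independent geometric random variables with $\mathbb{P}[\xi_p=k]=(1-p^{-1})p^{-k}$, $k\in\mathbb{N}_0$. Define $$c_1=\sup_{p\in\mathcal{P}}|\psi(p)|,\qquad c_2=\Big(\sum_{p\in\mathcal{P}}\frac{\mathbb{E}[\psi(p^{\xi_p+2})^2]}{p^2}\Big)^{1/2},$$ $$\mu_n=\sum_{p\in\mathcal{P}_n}\psi(p)p^{-1}(1-p^{-1})^{-1},\qquad \sigma_n^2=\sum_{p\in\mathcal{P}_n}\psi(p)^2p^{-1}(1-p^{-1})^{-2},\quad \sigma_n\ge 0.$$ For random variables $X,Y$: $d_{\mathrm K}(X,Y)=\sup_{z\in\mathbb{R}}|\mathbb{P}[X\le z]-\mathbb{P}[Y\le z]|$ (Kolmogorov distance) and $d_1(X,Y)=\sup_h|\mathbb{E}[h(X)]-\mathbb{E}[h(Y)]|$, the supremum being over Lipschitz $h:\mathbb{R}\to\mathbb{R}$ with Lipschitz constant at most one (1-Wasserstein distance). *)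

(* Defs.v *)
From HB Require Import structures.
From mathcomp Require Import all_boot all_order all_algebra.
From mathcomp Require Import all_classical all_reals all_analysis.

Set Implicit Arguments.
Unset Strict Implicit.
Unset Printing Implicit Defensive.

Import Order.TTheory GRing.Theory Num.Theory.
Import numFieldNormedType.Exports.

Local Open Scope classical_set_scope.
Local Open Scope ring_scope.

(* Functions on the positive integers are functions on [nat] whose value at 0
   is junk: it is never constrained, and it never enters a formula except on
   events of probability 0. *)
Definition additive_arith (R : realType) (psi : nat -> R) :=
  forall j k : nat, (0 < j)%N -> (0 < k)%N -> coprime j k ->
    psi (j * k)%N = psi j + psi k.

Definition geometric_rv d (T : measurableType d) (R : realType)
    (P : probability T R) (X : {RV P >-> nat}) (p : nat) :=
  forall k : nat,
    P (X @^-1` [set k]) = ((1 - p%:R^-1) * p%:R ^- k)%:E.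

Definition mutually_independent d (T : measurableType d) (R : realType)
    (P : probability T R) (I : pred nat) (X : nat -> {RV P >-> nat}) :=
  forall (s : seq nat) (A : nat -> set nat), uniq s -> all I s ->
    P (\bigcap_(i in [set` s]) (X i @^-1` A i)) =
    (\prod_(i <- s) P (X i @^-1` A i))%E.

(* Only the variables [xi p] with [p] prime matter. *)
Definition indep_geometric_family d (T : measurableType d) (R : realType)
    (P : probability T R) (xi : nat -> {RV P >-> nat}) :=
  (forall p, prime p -> geometric_rv (xi p) p) /\
  mutually_independent prime xi.

Section ErdosKac.
Context {R : realType}.
Implicit Types psi : nat -> R.

Definition c1 psi : \bar R :=
  ereal_sup [set (`|psi p|)%:E | p in [set p | prime p]].

Definition c2 psi d (T : measurableType d) (P : probability T R)
    (xi : nat -> {RV P >-> nat}) : \bar R :=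
  sqrte (\esum_(p in [set p | prime p])
    ('E_P[fun w => (psi (p ^ (xi p w + 2))%N ^+ 2)%R] * (p%:R ^- 2)%:E))%E.

Definition mu_ psi (n : nat) : R :=
  \sum_(1 <= p < n.+1 | prime p) psi p * p%:R^-1 * (1 - p%:R^-1)^-1.

Definition sigma_ psi (n : nat) : R :=
  Num.sqrt (\sum_(1 <= p < n.+1 | prime p)
    psi p ^+ 2 * p%:R^-1 * (1 - p%:R^-1) ^- 2).

Definition L_ (n : nat) : R := \sum_(1 <= j < n.+1) j%:R^-1.

(* The values 1/(L_ n * k), 1 <= k <= n, sum to 1, so that the other values
   of [H] have probability 0. *)
Definition harmonic_rv d (T : measurableType d) (P : probability T R)
    (H : {RV P >-> nat}) (n : nat) :=
  forall k : nat, (1 <= k <= n)%N ->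
    P (H @^-1` [set k]) = ((L_ n * k%:R)^-1)%:E.

Definition standard_gaussian_rv d (T : measurableType d) (P : probability T R)
    (N : {RV P >-> R}) :=
  forall A : set R, measurable A -> distribution P N A = normal_prob 0 1 A.

Definition normalize psi (n k : nat) : R := (psi k - mu_ psi n) / sigma_ psi n.

Lemma measurable_normalize psi n : measurable_fun setT (normalize psi n).
Proof. by []. Qed.

HB.instance Definition _ psi n :=
  isMeasurableFun.Build _ _ nat R (normalize psi n) (measurable_normalize psi n).

Definition normalized_rv psi n d (T : measurableType d) (P : probability T R)
    (H : {RV P >-> nat}) : {RV P >-> R} := normalize psi n \o H.

End ErdosKac.

(* Kolmogorov and 1-Wasserstein distances; the two random variables may live on
   different probability spaces. *)
Section Distances.
Context {R : realType}.
Context d1 (T1 : measurableType d1) (P1 : probability T1 R).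
Context d2 (T2 : measurableType d2) (P2 : probability T2 R).

Definition dK (X : {RV P1 >-> R}) (Y : {RV P2 >-> R}) : \bar R :=
  ereal_sup [set `|cdf X z - cdf Y z|%E | z in [set: R]].

(* For integrable [X] and [Y] all the expectations below are finite. *)
Definition dW (X : {RV P1 >-> R}) (Y : {RV P2 >-> R}) : \bar R :=
  ereal_sup [set `|'E_P1[h \o X] - 'E_P2[h \o Y]|%E |
               h in [set h : R -> R | 1.-lipschitz h]].

End Distances.

(* Main.v *)
(** Stein's method for the harmonic law.  Write E for the expectation under
P(H = k) = 1 / (L_n k).  Since P(H = p k) = P(H = k) / p whenever p k <= n,
H satisfies for every prime p the exact identity
  E[1(p || H) g(H)] = p^-1 E[1(p does not divide H) 1(p H <= n) g(p H)],
where p || H means that p divides H exactly once, and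
W = (psi(H) - mu_n) / sigma_n is shifted by a_p = psi(p) / sigma_n when H is
replaced by p H.  Summing over p gives
E[W f(W)] = sum_p (a_p / p) E[1(p does not divide H) (f(W + a_p) - f(W))] up to
two errors: the prime powers p^k, k >= 2, dividing H, controlled by c_2, and the
event p H > n, controlled by sum_p p^-1 P(p H > n) <= 8, which follows from an
elementary upper bound of Mertens type.  Thus the independent geometric
variables enter only through the moments defining c_2.

For a Lipschitz test function the Stein solution has a Lipschitz derivative and a
Taylor expansion concludes.  For a decreasing test function h with values in
[0, 1] the derivative of the Stein solution f is w f(w) + h(w) - E h(N), where
w f(w) is increasing; the Taylor remainder is then bounded by increments of the
bounded increasing function w f(w) - h(w), and the identity read backwards turns
the sum of these increments into E[V q(W)] with V of standard deviation
O(c_1 / sigma_n).  Ramps approximating the indicator of ]-oo, z] then give the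
Kolmogorov bound without any concentration inequality. *)

Require Import Defs.
From HB Require Import structures.
From mathcomp Require Import all_boot all_order all_algebra.
From mathcomp Require Import all_classical all_reals all_analysis.
From mathcomp Require Import measurable_realfun zify ring lra.

Set Implicit Arguments.
Unset Strict Implicit.
Unset Printing Implicit Defensive.

Import Order.TTheory GRing.Theory Num.Theory.
Import numFieldNormedType.Exports.

Local Open Scope classical_set_scope.
Local Open Scope ring_scope.

(** * Stein equation by comparison *)

Section Comparison.
Context {R : realType}.
Implicit Types (G F m r dG : R -> R) (x y w K : R).

Lemma derive_ge0_le G dG (a b : R) : a <= b ->
  (forall x : R, a <= x -> is_derive x 1 G (dG x)) -> (forall x, a <= x -> 0 <= dG x) ->
  G a <= G b.
Proof.
move=> ab GdG dG0.
have [x xab||c] := @MVT_segment _ G dG a b ab.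
- by apply: GdG; move: xab; rewrite in_itv/= => /andP[/ltW].
- apply: continuous_in_subspaceT => x; rewrite inE/= in_itv/= => /andP[ax _].
  apply: differentiable_continuous; apply/derivable1_diffP.
  by case: (GdG _ ax).
rewrite in_itv/= => /andP[ac _] E.
by rewrite -subr_ge0 E mulr_ge0 ?dG0// subr_ge0.
Qed.

(** The endpoints come in either order because the shifts [a p] of [W] can have either sign. *)
Lemma mean_value G dG (x y : R) : (forall z, is_derive (z : R) 1 G (dG z)) ->
  exists2 c, Num.min x y <= c <= Num.max x y & G y - G x = dG c * (y - x).
Proof.
move=> GdG.
have Gc (a b : R) : {within `[a, b], continuous G}.
  apply: continuous_subspaceT => z.
  by apply: differentiable_continuous; apply/derivable1_diffP; case: (GdG z).
have [xy|/ltW xy] := leP x y.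
  have [//|c cab E] := @MVT_segment _ G dG x y xy.
  by exists c => //; move: cab; rewrite in_itv.
have [//|c cab E] := @MVT_segment _ G dG y x xy.
by exists c; [move: cab; rewrite in_itv | rewrite -opprB E -mulrN opprB].
Qed.

(** Limits are taken along the integers only: the comparison arguments merely use points far to the
    right where [G] is small. *)
Definition vanishes G := G n%:R @[n --> \oo] --> (0 : R).

Lemma vanishesD F G : vanishes F -> vanishes G -> vanishes (fun x => F x + G x).
Proof. by move=> F0 G0; rewrite /vanishes -[0]addr0; exact: cvgD. Qed.

Lemma vanishesN F : vanishes F -> vanishes (fun x => - F x).
Proof. by move=> F0; rewrite /vanishes -[0]oppr0; exact: cvgN. Qed.

Lemma vanishes_le F G : (forall x, 0 <= x -> `|F x| <= G x) -> vanishes G -> vanishes F.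
Proof.
move=> FG /cvgr0Pnorm_le G0; apply/cvgr0Pnorm_le => e e0.
have := G0 _ e0; apply: filterS => n /= H.
by rewrite (le_trans _ H)// (le_trans (FG _ _))// ler_norm.
Qed.

Lemma vanishesZ F c : vanishes F -> vanishes (fun x => c * F x).
Proof.
by move=> F0; rewrite /vanishes -[0](mulr0 c); apply: cvgM => //; exact: cvg_cst.
Qed.

(** If [G w] were positive, [G] would stay above [G w] on the right of [w], against its limit 0. *)
Lemma vanishes_derive_ge0 G dG w : vanishes G ->
  (forall x : R, w <= x -> is_derive x 1 G (dG x)) -> (forall x, w <= x -> 0 <= dG x) ->
  G w <= 0.
Proof.
move=> /cvgr0Pnorm_le G0 GdG dG0; rewrite leNgt; apply/negP => Gw.
have Gw2 : 0 < G w / 2 by rewrite divr_gt0.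
have [n /= [Hn wn]] : exists n : nat, `|G n%:R| <= G w / 2 /\ w <= n%:R.
  have H : \forall n \near \oo, `|G n%:R| <= G w / 2 /\ w <= n%:R.
    by apply: filterI; [exact: G0 | exact: nbhs_infty_ger].
  exact: filter_ex H.
have := derive_ge0_le wn GdG dG0.
move: (ler_norm (G n%:R)); lra.
Qed.

Lemma is_derive_opp F (dF : R -> R) : (forall x, is_derive (x : R) 1 F (dF x)) ->
  forall x : R, is_derive x 1 (fun x => F (- x)) (- dF (- x)).
Proof.
move=> FdF x.
have := @is_derive1_comp _ F -%R x (dF (- x)) (-1) (FdF _) (is_deriveNid _ _).
by rewrite mulrN1.
Qed.

Definition gam (x : R) : R := expR (- (x ^+ 2 / 2)).

Lemma gam_gt0 x : 0 < gam x. Proof. exact: expR_gt0. Qed.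

Lemma gamN x : gam (- x) = gam x. Proof. by rewrite /gam sqrrN. Qed.

Lemma is_derive_gam (x : R) : is_derive x 1 gam (- x * gam x).
Proof.
have -> : gam = expR \o (fun x : R => - (2^-1) * (x ^+ 2)).
  by apply/funext => y; rewrite /gam/= mulNr mulrC.
have H : is_derive (x:R) 1 (fun x : R => - (2^-1) * (x ^+ 2)) (- x).
  apply: is_derive_eq; rewrite /GRing.scale/=; lra.
apply: is_derive_eq; rewrite /GRing.scale/= mulrC; congr (_ * _).
Qed.

Lemma gam_le x : gam x <= (1 + x ^+ 2 / 2)^-1.
Proof.
rewrite /gam expRN lef_pV2 ?posrE ?expR_gt0//; last first.
  by rewrite ltr_pwDl// divr_ge0// sqr_ge0.
exact: expR_ge1Dx.
Qed.

Lemma vanishes_inv : vanishes (fun x => (1 + x)^-1).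
Proof.
rewrite /vanishes; under eq_fun do rewrite -[1]/(1%:R) -natrD add1n.
exact: cvg_harmonic.
Qed.

Lemma vanishes_gam : vanishes gam.
Proof.
apply: (@vanishes_le _ (fun x => 2 * (1 + x)^-1)); last exact: vanishesZ vanishes_inv.
move=> x x0; rewrite gtr0_norm ?gam_gt0// (le_trans (gam_le _))//.
rewrite -[2]invrK -invfM lef_pV2 ?posrE; first by nra.
- by rewrite ltr_pwDl// divr_ge0// sqr_ge0.
- by rewrite mulr_gt0// ltr_pwDl.
Qed.

(* Comparison of [G] with [4/3 K gam x / (1 + x)], whose derivative is at most [- K gam x]. *)
Lemma gauss_comparison_ge0 G r K w : 0 <= w -> vanishes G ->
  (forall x : R, is_derive x 1 G (r x * gam x)) -> (forall x, `|r x| <= K) ->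
  G w <= 4 / 3 * K * gam w / (1 + w).
Proof.
move=> w0 G0 dG rK.
have K0 : 0 <= K by rewrite (le_trans _ (rK 0)).
rewrite -subr_le0.
pose c : R -> R := fun x : R => 4 / 3 * K * (gam x * (1 + x)^-1).
pose dc : R -> R := fun x : R => 4 / 3 * K * (gam x * (- (x ^+ 2 + x + 1) / (1 + x) ^+ 2)).
have dcc x : w <= x -> is_derive x 1 c (dc x).
  move=> wx; have x1 : 1 + x != 0 by rewrite gt_eqF// ltr_pwDl// (le_trans w0).
  have H := is_derive_gam x.
  have H1 : is_derive x 1 (fun x : R => 1 + x) 1.
    by apply: is_derive_eq; rewrite add0r mulr1.
  have H2 := @is_deriveV _ _ x 1 1 x1 H1.
  rewrite /c; apply: is_derive_eq; rewrite /GRing.scale/= /dc.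
  by field.
have -> : 4 / 3 * K * gam w / (1 + w) = c w by rewrite /c mulrA.
apply: (@vanishes_derive_ge0 (fun x => G x - c x) (fun x => r x * gam x - dc x) w).
- apply: vanishesD => //; apply: vanishesN; apply: vanishesZ.
  apply: (vanishes_le _ vanishes_gam) => x x0.
  rewrite ger0_norm ?mulr_ge0 ?invr_ge0 ?addr_ge0//; last exact/ltW/gam_gt0.
  by rewrite ler_piMr ?invf_le1 ?lerDl// ?ltr_pwDl//; exact/ltW/gam_gt0.
- by move=> x wx; have := dcc x wx; exact: is_deriveB.
- move=> x wx; have x0 : 0 <= x by exact: le_trans wx.
  have g0 := gam_gt0 x.
  rewrite /dc mulrCA (mulrC (r x)) -mulrBr mulr_ge0 ?(ltW g0)//.
  have := rK x; rewrite ler_norml => /andP[rx _].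
  (* The minimum 3/4 of this quotient, reached at [x = 1], is what the factor 4/3 of the barrier
     compensates. *)
  have P : 3 / 4 <= (x ^+ 2 + x + 1) / (1 + x) ^+ 2.
    rewrite ler_pdivlMr ?exprn_gt0 ?ltr_pwDl//.
    by have := sqr_ge0 (x - 1); lra.
  rewrite mulNr; nra.
Qed.

(** Reflecting [x] to [- x] covers negative [w], and changing the sign of [G] gives the lower
    bound. *)
Lemma gauss_comparison G r K w : vanishes G -> vanishes (fun x => G (- x)) ->
  (forall x : R, is_derive x 1 G (r x * gam x)) -> (forall x, `|r x| <= K) ->
  `|G w| <= 4 / 3 * K * gam w / (1 + `|w|).
Proof.
wlog w0 : G r w / 0 <= w => [hwlog|] G0 G0' dG rK.
  have [w0|w0] := leP 0 w; first exact: (hwlog G r).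
  have := hwlog (fun x => G (- x)) (fun x => - r (- x)) (- w).
  rewrite opprK normrN gamN; apply; rewrite ?oppr_ge0 ?(ltW w0)//.
  - by under eq_fun do rewrite opprK.
  - move=> x; have := is_derive_opp dG x; rewrite gamN.
    by move=> H; apply: is_derive_eq H _; rewrite mulNr.
  - by move=> x; rewrite normrN.
rewrite (ger0_norm w0) ler_norml; apply/andP; split; last exact: (@gauss_comparison_ge0 _ r).
rewrite lerNl; apply: (@gauss_comparison_ge0 (fun x => - G x) (fun x => - r x)) => //.
- exact: vanishesN.
- by move=> x; have := dG x; move=> H; apply: is_derive_eq; rewrite mulNr.
- by move=> x; rewrite normrN.
Qed.

(** The derivative of [F] has the sign of the nonincreasing [m], so [F] rises from 0 and then falls
    back to 0. According to the sign of [m w], the comparison is run on the left or on the right of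
    [w]. *)
Lemma gauss_primitive_nincr_ge0 F m w : vanishes F -> vanishes (fun x => F (- x)) ->
  (forall x : R, is_derive x 1 F (m x * gam x)) -> {homo m : x y /~ x <= y} ->
  0 <= F w.
Proof.
move=> F0 F0' dF mh; have [mw|mw] := leP 0 (m w).
- rewrite -oppr_le0 -[w]opprK.
  apply: (@vanishes_derive_ge0 (fun x => - F (- x)) (fun x => m (- x) * gam x)).
  + exact: vanishesN.
  + move=> x _; have := is_derive_opp dF x; rewrite gamN => H.
    by apply: is_derive_eq; rewrite opprK.
  + move=> x wx; rewrite mulr_ge0 ?(ltW (gam_gt0 _))// (le_trans mw)// mh//.
    by rewrite lerNl.
- rewrite -oppr_le0.
  apply: (@vanishes_derive_ge0 (fun x => - F x) (fun x => - m x * gam x)).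
  + exact: vanishesN.
  + by move=> x _; have H := dF x; apply: is_derive_eq; rewrite mulNr.
  + move=> x wx; rewrite mulr_ge0 ?(ltW (gam_gt0 _))// oppr_ge0.
    by rewrite (le_trans (mh _ _ wx))// ltW.
Qed.

(* The derivative of [w f(w)], with [f = F / gam], is this quantity over [gam w]. *)
Lemma gauss_primitive_nincr_convex F m w : vanishes F -> vanishes (fun x => F (- x)) ->
  (forall x : R, is_derive x 1 F (m x * gam x)) -> {homo m : x y /~ x <= y} ->
  0 <= (1 + w ^+ 2) * F w + w * m w * gam w.
Proof.
wlog w0 : F m w / 0 <= w => [hwlog|] F0 F0' dF mh.
  have [w0|w0] := leP 0 w; first exact: (hwlog F m).
  have := hwlog (fun x => F (- x)) (fun x => - m (- x)) (- w).
  rewrite !opprK sqrrN mulrNN gamN; apply; rewrite ?oppr_ge0 ?(ltW w0)//.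
  - by under eq_fun do rewrite opprK.
  - move=> x; have := is_derive_opp dF x; rewrite gamN.
    by move=> H; apply: is_derive_eq H _; rewrite mulNr.
  - by move=> x y xy; rewrite lerN2 mh// lerN2.
have Fw := gauss_primitive_nincr_ge0 w F0 F0' dF mh.
have g0 := gam_gt0 w.
have [mw|mw] := leP 0 (m w); first by rewrite addr_ge0 ?mulr_ge0 ?addr_ge0 ?sqr_ge0// ltW.
pose k := - m w.
have k0 : 0 < k by rewrite oppr_gt0.
(* [c] is the classical lower bound of the Gaussian tail. Its derivative is at least [- gam], while
   [m <= - k] on the right of [w]; hence [k * c - F] increases to 0 there and is nonpositive at
   [w]. *)
pose c : R -> R := fun x : R => x * gam x * (1 + x ^+ 2)^-1.
have D1 x : 0 < 1 + x ^+ 2 :> R by rewrite ltr_pwDl// sqr_ge0.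
pose dc : R -> R := fun x : R => - gam x * (1 - 2 / (1 + x ^+ 2) ^+ 2).
have dcc (x : R) : is_derive x 1 c (dc x).
  have x1 : 1 + x ^+ 2 != 0 by rewrite gt_eqF.
  have H := is_derive_gam x.
  have H1 : is_derive x 1 (fun x : R => 1 + x ^+ 2) (2 * x).
    by apply: is_derive_eq; rewrite /GRing.scale/=; ring.
  have H2 := @is_deriveV _ _ x (2 * x) 1 x1 H1.
  rewrite /c; apply: is_derive_eq; rewrite /GRing.scale/= /dc.
  by field.
have : k * c w - F w <= 0.
  apply: (@vanishes_derive_ge0 (fun x => k * c x - F x)
           (fun x => k * dc x - m x * gam x)).
  - apply: vanishesD; last exact: vanishesN.
    apply: vanishesZ; apply: (vanishes_le _ vanishes_gam) => x x0.
    rewrite /c ger0_norm; last by rewrite divr_ge0 ?mulr_ge0 ?(ltW (gam_gt0 _)) ?(ltW (D1 _)).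
    rewrite ler_pdivrMr// mulrC ler_pM2l ?gam_gt0//; nra.
  - move=> x wx; have gx := gam_gt0 x.
    have -> : k * dc x - m x * gam x = gam x * - (m x + k * (1 - 2 / (1 + x ^+ 2) ^+ 2)).
      by rewrite /dc; ring.
    rewrite pmulr_rge0//.
    have : m x <= - k by rewrite /k opprK mh.
    have : 0 <= 2 / (1 + x ^+ 2) ^+ 2 by rewrite divr_ge0// exprn_ge0// ltW.
    nra.
rewrite subr_le0 /c mulrA ler_pdivrMr//.
rewrite /k; lra.
Qed.

(** * The solution of the Stein equation and its derivative *)

Section SteinSolution.
Variables (h : R -> R) (e : R) (F : R -> R).
Hypothesis dF : forall x : R, is_derive x 1 F ((h x - e) * gam x).
Hypotheses (F0 : vanishes F) (F0' : vanishes (fun x => F (- x))).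

(** As [F] is the primitive of [(h - e) * gam] vanishing at both ends, the quotient solves the Stein
    equation f'(x) - x f(x) = h(x) - e; [stein_dsol] is f' read off from this equation. *)
Definition stein_sol x := F x / gam x.
Local Notation f := stein_sol.

Definition stein_dsol x := x * f x + (h x - e).

Lemma stein_solE x : F x = f x * gam x.
Proof. by rewrite /stein_sol divfK// gt_eqF// gam_gt0. Qed.

Lemma is_derive_stein_sol x : is_derive x 1 f (stein_dsol x).
Proof.
have g0 : gam x != 0 by rewrite gt_eqF// gam_gt0.
have H2 := @is_deriveV _ _ x _ 1 g0 (is_derive_gam x).
have H := dF x.
rewrite /f; apply: is_derive_eq; rewrite /GRing.scale/= /stein_dsol /f.
by field.
Qed.

(** * Bounds on the Stein solution for a 1-Lipschitz test function *)

Section Lipschitz.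
Hypothesis hL : forall x y, `|h x - h y| <= `|x - y|.

(** The functions [gam + F] and [gam - F] have derivatives [(h - e - x) * gam] and
    [(e - h - x) * gam], whose first factors are nonincreasing because [h] is 1-Lipschitz; both
    functions are therefore nonnegative. *)
Lemma stein_sol_lipschitz_le1 x : `|f x| <= 1.
Proof.
have gx := gam_gt0 x.
have V := vanishes_gam.
have VN : vanishes (fun x => gam (- x)) by under eq_fun do rewrite gamN.
have hxy (a b : R) : a <= b -> h b - h a <= b - a /\ h a - h b <= b - a.
  move=> ab; have := hL b a; rewrite (ger0_norm (_ : 0 <= b - a)) ?subr_ge0// ler_norml.
  by move=> /andP[]; split; lra.
rewrite /f normrM normfV (gtr0_norm gx) ler_pdivrMr// mul1r ler_norml; apply/andP; split.
- have : 0 <= F x + gam x; last lra.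
  apply: (@gauss_primitive_nincr_ge0 (fun x => F x + gam x) (fun x => h x - e - x)).
  + exact: vanishesD.
  + exact: vanishesD.
  + move=> y; have H := dF y; have H' := is_derive_gam y.
    by apply: is_derive_eq; ring.
  + by move=> a b /hxy[? ?]; lra.
- have : 0 <= gam x - F x; last lra.
  apply: (@gauss_primitive_nincr_ge0 (fun x => gam x - F x) (fun x => e - h x - x)).
  + by apply: vanishesD => //; exact: vanishesN.
  + by apply: vanishesD => //; exact: (@vanishesN (fun x => F (- x))).
  + move=> y; have H := dF y; have H' := is_derive_gam y.
    by apply: is_derive_eq; ring.
  + by move=> a b /hxy[? ?]; lra.
Qed.

(** The increment y -> f(y + s) - f(y) solves the Stein equation with right-hand side s f(y + s) +
    h(y + s) - h(y), bounded by 2|s|, so that [gauss_comparison] applies to it. *)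
Lemma stein_sol_lipschitz x s : `|f (x + s) - f x| <= 8 / 3 * `|s| / (1 + `|x|).
Proof.
have gx := gam_gt0 x.
pose G y := (f (y + s) - f y) * gam y.
have VG : vanishes G /\ vanishes (fun y => G (- y)).
  have GB y : `|G y| <= 2 * gam y.
    rewrite normrM (gtr0_norm (gam_gt0 y)) ler_wpM2r ?(ltW (gam_gt0 y))//.
    rewrite (le_trans (ler_normB _ _))//.
    by have := stein_sol_lipschitz_le1 y; have := stein_sol_lipschitz_le1 (y + s); lra.
  split; apply: (vanishes_le _ (vanishesZ 2 vanishes_gam)) => y _//.
  by rewrite -(gamN y).
have [VG1 VG2] := VG.
have dG y : is_derive y 1 G ((s * f (y + s) + (h (y + s) - h y)) * gam y).
  have H := is_derive_stein_sol y; have H' := is_derive_gam y.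
  have H1 : is_derive y 1 (fun y => f (y + s)) (stein_dsol (y + s)).
    have K1 : is_derive y 1 (fun y => y + s) 1 by apply: is_derive_eq; rewrite addr0.
    have := @is_derive1_comp _ f (fun y => y + s) y _ _ (is_derive_stein_sol _) K1.
    by rewrite mulr1.
  rewrite /G; apply: is_derive_eq; rewrite /GRing.scale/= /stein_dsol; ring.
have rK y : `|s * f (y + s) + (h (y + s) - h y)| <= 2 * `|s|.
  rewrite (le_trans (ler_normD _ _))// normrM.
  have := hL (y + s) y; rewrite (_ : y + s - y = s); last by ring.
  have := stein_sol_lipschitz_le1 (y + s); have := normr_ge0 s; nra.
have := gauss_comparison x VG1 VG2 dG rK.
rewrite /G normrM (gtr0_norm gx) => H.
rewrite -(ler_pM2r gx); apply: (le_trans H).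
by rewrite le_eqVlt; apply/orP; left; apply/eqP; field; rewrite gt_eqF// ltr_pwDl.
Qed.

(** The factor [x] in [x * f x] is absorbed by the decay of the increments of [f] in 1/(1 + |x|).
    The total 8/3 + 2 is rounded up to 5. *)
Lemma stein_dsol_lipschitz x s : `|stein_dsol (x + s) - stein_dsol x| <= 5 * `|s|.
Proof.
have -> : stein_dsol (x + s) - stein_dsol x =
    x * (f (x + s) - f x) + (s * f (x + s) + (h (x + s) - h x)).
  by rewrite /stein_dsol; ring.
rewrite (le_trans (ler_normD _ _))// normrM.
have H1 : `|s * f (x + s) + (h (x + s) - h x)| <= 2 * `|s|.
  rewrite (le_trans (ler_normD _ _))// normrM.
  have := hL (x + s) x; rewrite (_ : x + s - x = s); last by ring.
  have := stein_sol_lipschitz_le1 (x + s); have := normr_ge0 s; nra.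
have x1 : 0 < 1 + `|x| by rewrite ltr_pwDl.
have H2 : `|x| * `|f (x + s) - f x| <= 8 / 3 * `|s|.
  have := stein_sol_lipschitz x s; rewrite ler_pdivlMr//.
  by have := normr_ge0 (f (x + s) - f x); nra.
have := normr_ge0 s; lra.
Qed.

Lemma stein_taylor_lipschitz x s : `|f (x + s) - f x - s * stein_dsol x| <= 5 * s ^+ 2.
Proof.
have [c cx E] := mean_value x (x + s) is_derive_stein_sol.
have -> : f (x + s) - f x - s * stein_dsol x = s * (stein_dsol (x + (c - x)) - stein_dsol x).
  by rewrite E (_ : x + (c - x) = c); ring.
rewrite normrM (le_trans (ler_wpM2l _ (stein_dsol_lipschitz _ _)))//.
have cs : `|c - x| <= `|s|.
  move: cx; rewrite ge_min le_max => /andP[/orP[] c1 /orP[] c2];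
   case: (ler0P s) => ?; case: (ler0P (c - x)) => ?; lra.
rewrite -(real_normK (num_real s)); have := normr_ge0 s; nra.
Qed.

(** A difference quotient of [f] with step s is at most 8/3 and differs from the derivative by at
    most 5 s; the step 1/15 makes the sum equal to 3. *)
Lemma stein_dsol_lipschitz_le3 x : `|stein_dsol x| <= 3.
Proof.
have := stein_taylor_lipschitz x 15^-1; have := stein_sol_lipschitz x 15^-1.
have i0 : 0 <= 15^-1 :> R by [].
have xB : 8 / 3 * 15^-1 / (1 + `|x|) <= 8 / 3 * 15^-1.
  by rewrite ler_piMr// invf_le1 ?ltr_pwDl// lerDl.
rewrite (ger0_norm i0) => /le_trans/(_ xB); rewrite !ler_norml => /andP[? ?] /andP[? ?].
by apply/andP; split; lra.
Qed.

End Lipschitz.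

(** * Bounds on the Stein solution for a decreasing test function with values in [0, 1] *)

Section Monotone.
Hypothesis h01 : forall x, 0 <= h x <= 1.
Hypothesis e01 : 0 <= e <= 1.
Hypothesis hh : {homo h : x y /~ x <= y}.

(** [gauss_comparison] applies with [K = 1], since [h] and [e] both lie in [0, 1]. *)
Lemma stein_sol_monotone x : `|f x| <= 4 / 3 / (1 + `|x|).
Proof.
have gx := gam_gt0 x.
have rK y : `|h y - e| <= 1.
  rewrite ler_norml; have := h01 y; move: e01 => /andP[? ?] /andP[? ?].
  by apply/andP; split; lra.
have := gauss_comparison x F0 F0' dF rK.
rewrite stein_solE normrM (gtr0_norm gx) => H.
rewrite -(ler_pM2r gx); apply: (le_trans H).
by rewrite le_eqVlt; apply/orP; left; apply/eqP; field; rewrite gt_eqF// ltr_pwDl.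
Qed.

Lemma stein_sol_monotone_le x : `|f x| <= 4 / 3.
Proof.
rewrite (le_trans (stein_sol_monotone x))// ler_piMr//.
by rewrite invf_le1 ?ltr_pwDl// lerDl.
Qed.

Lemma stein_sol_monotone_mul_le x : `|x * f x| <= 4 / 3.
Proof.
have x1 : 0 < 1 + `|x| by rewrite ltr_pwDl.
have := stein_sol_monotone x; rewrite ler_pdivlMr// [`|x * f x|]normrM.
by have := normr_ge0 (f x); nra.
Qed.

Lemma stein_dsol_monotone_le x : `|stein_dsol x| <= 7 / 3.
Proof.
have := stein_sol_monotone_mul_le x; have := h01 x.
rewrite /stein_dsol !ler_norml; move: e01 => /andP[? ?] /andP[? ?] /andP[? ?].
by apply/andP; split; lra.
Qed.

(** The derivative times [gam] is the expression of [gauss_primitive_nincr_convex] for the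
    nonincreasing function [h - e]. *)
Lemma stein_sol_mul_homo : {homo (fun x => x * f x) : x y / x <= y}.
Proof.
move=> x y xy.
apply: (@derive_ge0_le (fun x => x * f x) (fun x => f x + x * stein_dsol x)) => // z _.
  have H := is_derive_stein_sol z.
  by apply: is_derive_eq; rewrite /GRing.scale/=; ring.
have gz := gam_gt0 z.
rewrite -(pmulr_lge0 _ gz).
have -> : (f z + z * stein_dsol z) * gam z = (1 + z ^+ 2) * F z + z * (h z - e) * gam z.
  by rewrite stein_solE /stein_dsol; ring.
by apply: (gauss_primitive_nincr_convex _ F0 F0' dF) => a b ab; rewrite lerB// hh.
Qed.

(** Both [x * f x] and [- h] are nondecreasing, so increments of this bounded function dominate the
    variation of each of the two terms of [stein_dsol]. *)
Definition stein_monot x := x * f x - h x.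

Lemma stein_monot_le x : `|stein_monot x| <= 7 / 3.
Proof.
have := stein_sol_monotone_mul_le x; have := h01 x.
rewrite /stein_monot !ler_norml; move=> /andP[? ?] /andP[? ?].
by apply/andP; split; lra.
Qed.

(* Both monotone parts of [stein_dsol] vary on [[x, x + s]] by at most the increment of [stein_monot]. *)
Lemma stein_taylor_monotone x s :
  `|f (x + s) - f x - s * stein_dsol x| <= s * (stein_monot (x + s) - stein_monot x).
Proof.
have [c cx E] := mean_value x (x + s) is_derive_stein_sol.
have -> : f (x + s) - f x - s * stein_dsol x = s * (stein_dsol c - stein_dsol x).
  by rewrite E; ring.
rewrite /stein_dsol /stein_monot ler_norml.
have [s0|s0] := leP 0 s.
- have xs : x <= x + s by rewrite lerDl.
  move: cx; rewrite (min_l xs) (max_r xs) => /andP[c1 c2].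
  have := stein_sol_mul_homo c1; have := stein_sol_mul_homo c2 => /=.
  have := hh c1; have := hh c2; have := hh xs.
  by move=> *; apply/andP; split; nra.
- have xs : x + s <= x by rewrite gerDl ltW.
  move: cx; rewrite (min_r xs) (max_l xs) => /andP[c1 c2].
  have := stein_sol_mul_homo c1; have := stein_sol_mul_homo c2 => /=.
  have := hh c1; have := hh c2; have := hh xs.
  by move=> *; apply/andP; split; nra.
Qed.

End Monotone.
End SteinSolution.
End Comparison.

(** * Gaussian integrals *)

Section GaussianIntegral.
Context {R : realType}.
Implicit Types (h : R -> R) (x y w : R).
Local Notation mu := (@lebesgue_measure R).
Local Notation phi := (normal_pdf (0 : R) 1).
Local Notation pk := (normal_peak (1 : R)).

Lemma normal_peak1_gt0 : 0 < pk.
Proof. by rewrite normal_peak_gt0. Qed.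

Lemma normal_pdf_gam x : phi x = pk * gam x.
Proof.
rewrite normal_pdfE ?oner_eq0// /normal_fun /gam subr0 expr1n mulr2n.
by congr (_ * expR _); lra.
Qed.

Lemma gam_normal_pdf x : gam x = pk^-1 * phi x.
Proof. by rewrite normal_pdf_gam mulKf// gt_eqF// normal_peak1_gt0. Qed.

Lemma continuous_gam : continuous (@gam R).
Proof.
move=> x; apply: differentiable_continuous; apply/derivable1_diffP.
by case: (is_derive_gam x).
Qed.

Definition normal_mean h : R := (\int[mu]_x (h x * phi x))%R.

Definition normal_integrable h := mu.-integrable [set: R] (EFin \o (fun x => h x * phi x)).

Lemma normal_integrable_cst (c : R) : normal_integrable (cst c).
Proof.
rewrite /normal_integrable.
have := @integrable_normal_pdf R 0 1.
move=> /(@integrableZl _ _ _ mu setT measurableT c).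
by apply: eq_integrable => // x _ /=.
Qed.

(** The dominating function is a multiple of the normal density of standard deviation 2: exp(-x^2/2)
    is exp(-3x^2/8) exp(-x^2/8), and the first factor absorbs the linear growth of [h]. *)
Lemma normal_integrable_lipschitz h (C : R) : continuous h ->
  (forall x, `|h x| <= C * (1 + `|x|)) -> normal_integrable h.
Proof.
move=> ch hC.
have C0 : 0 <= C by have := hC 0; rewrite normr0 addr0 mulr1; apply: le_trans.
pose c := C * (pk * 2) / normal_peak (2 : R).
have p2 : 0 < normal_peak (2 : R) by rewrite normal_peak_gt0.
have c0 : 0 <= c by rewrite divr_ge0 ?mulr_ge0// ltW// normal_peak1_gt0.
have I2 := @integrable_normal_pdf R 0 2.
have I3 := @integrableZl _ _ _ mu setT measurableT c _ I2.
apply: (le_integrable _ _ _ I3) => //.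
- apply/measurable_EFinP/measurable_funM.
    exact: continuous_measurable_fun.
  exact: measurable_normal_pdf.
- move=> x _ /=; rewrite lee_fin.
  have E2 : normal_pdf 0 2 x = normal_peak 2 * expR (- (x ^+ 2 / 8)).
    rewrite normal_pdfE ?pnatr_eq0// /normal_fun subr0.
    by congr (_ * expR _); lra.
  rewrite [X in _ <= X]ger0_norm; last first.
    by rewrite mulr_ge0// normal_pdf_ge0.
  rewrite normrM [X in _ * X <= _]ger0_norm ?normal_pdf_ge0//.
  rewrite normal_pdf_gam E2.
  have -> : c * (normal_peak 2 * expR (- (x ^+ 2 / 8))) =
      C * (pk * 2) * expR (- (x ^+ 2 / 8)).
    by rewrite /c; field; rewrite gt_eqF.
  have -> : @gam R x = expR (- (3 * x ^+ 2 / 8)) * expR (- (x ^+ 2 / 8)).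
    by rewrite -expRD /gam; congr expR; lra.
  have -> (u v : R) : `|h x| * (pk * (u * v)) = `|h x| * (pk * u) * v by ring.
  rewrite ler_pM2r ?expR_gt0//.
  have H : (1 + `|x|) * expR (- (3 * x ^+ 2 / 8)) <= 2.
    rewrite expRN ler_pdivrMr ?expR_gt0//.
    have := expR_ge1Dx (3 * x ^+ 2 / 8); rewrite -(real_normK (num_real x)).
    have := sqr_ge0 (`|x| - 2^-1); have := normr_ge0 x; nra.
  have e0 := expR_gt0 (- (3 * x ^+ 2 / 8)).
  have := ler_wpM2r (ltW e0) (hC x).
  have := ler_wpM2l C0 H.
  have := normal_peak1_gt0.
  move: (expR _) e0 H => E E0 H; move: (`|h x|) => a p1 h1 h2.
  have h3 : a * E <= C * 2 by lra.
  by have := ler_wpM2l (ltW p1) h3; lra.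
Qed.

(** Every point eventually leaves the sets [A n], so dominated convergence applies with |k| as
    dominating function; this serves both tails of the primitive below. *)
Lemma dominated_tail (k : R -> R) (A : nat -> set R) :
  mu.-integrable [set: R] (EFin \o k) -> (forall n, measurable (A n)) ->
  (forall x, \forall n \near \oo, ~ A n x) ->
  (\int[mu]_(x in A n) k x)%R @[n --> \oo] --> (0 : R).
Proof.
move=> ik mA nA.
pose f_ (n : nat) x := (k x * \1_(A n) x)%:E.
have mk : measurable_fun setT k by apply/measurable_EFinP; exact: (measurable_int mu).
have := @dominated_convergence _ _ _ mu setT measurableT f_ (cst 0%E) (fun x => `|k x|%:E).
move=> [].
- move=> n; apply/measurable_EFinP/measurable_funM => //.
  by apply: measurable_indic; exact: mA.
- exact: measurable_cst.
- apply: aeW => x _; apply: cvg_near_cst.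
  have := nA x; apply: filterS => n nAx.
  by rewrite /f_ indicE memNset// mulr0.
- exact: (integrable_norm ik).
- apply: aeW => x n _; rewrite /f_/= lee_fin normrM indicE.
  by case: (_ \in _); rewrite ?normr1 ?mulr1 ?normr0 ?mulr0.
- move=> _ _; rewrite integral_cst// mul0e => H.
  have E n : (\int[mu]_(x in setT) f_ n x)%E = (\int[mu]_(x in A n) (k x)%:E)%E.
    rewrite [RHS]integral_mkcond; apply: eq_integral => x _.
    by rewrite /f_ patchE indicE; case: ifP; rewrite ?mulr1 ?mulr0.
  rewrite -[0]/(fine 0%E).
  apply: (@fine_cvg _ _ _ _ (fun n => (\int[mu]_(x in A n) (k x)%:E)%E)).
  by under eq_fun do rewrite -E.
Qed.

(** [F] is the integral of [(h - e) * gam] over ]-oo, x]. Taking for [e] the Gaussian mean of [h]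
    makes the total integral 0, so [F] is also minus the integral over the right tail and vanishes
    at both ends. *)
Lemma gauss_primitive_exists h : continuous h -> normal_integrable h ->
  exists F : R -> R, [/\ forall x, is_derive x 1 F ((h x - normal_mean h) * gam x),
    vanishes F & vanishes (fun x => F (- x))].
Proof.
move=> ch ih; set e := normal_mean h.
pose k x : R := (h x - e) * gam x.
have ck : continuous k.
  move=> x; apply: cvgM; last exact: continuous_gam.
  by apply: cvgB; [exact: ch|exact: cvg_cst].
have kE x : k x = pk^-1 * (h x * phi x - e * phi x) by rewrite /k gam_normal_pdf; ring.
have i1 := normal_integrable_cst e.
have ik : mu.-integrable [set: R] (EFin \o k).
  have := @integrableZl _ _ _ mu setT measurableT pk^-1 _ (integrableB measurableT ih i1).
  by apply: eq_integrable => // x _ /=; rewrite kE.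
have k0 : (\int[mu]_x k x)%R = 0.
  under eq_Rintegral do rewrite kE.
  rewrite RintegralZl//; last first.
    by have := integrableB measurableT ih i1; exact: eq_integrable.
  rewrite RintegralB// -/(normal_mean h) -/e.
  rewrite RintegralZl//; last exact: integrable_normal_pdf.
  by rewrite /Rintegral integral_normal_pdf/= mulr1 subrr mulr0.
pose F x : R := (\int[mu]_(t in [set` Interval -oo%O (BRight x)]) k t)%R.
have iS (A : set R) : measurable A -> mu.-integrable A (EFin \o k).
  by move=> mA; apply: integrableS ik.
exists F; split.
- move=> x.
  have [||||] := @continuous_FTC1 R k -oo%O x (x + 1).
  + by rewrite ltrDl.
  + exact: iS.
  + by rewrite ltNyr.
  + exact: ck.
  move=> d1 d2; apply: DeriveDef => //.
  by rewrite -derive1E.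
- have T (n : nat) : F n%:R = - (\int[mu]_(x in `]n%:R, +oo[) k x)%R.
    apply/eqP; rewrite -addr_eq0; apply/eqP.
    rewrite -[RHS]k0 -(@itv_setU_setT _ R false n%:R) Rintegral_setU//.
    + by rewrite itv_setU_setT.
    + apply/disj_setPS => y [] /=; rewrite !in_itv/= andbT => y1 y2.
      by move: (le_lt_trans y1 y2); rewrite ltxx.
  rewrite /vanishes; under eq_fun do rewrite T.
  rewrite -[0]oppr0; apply: cvgN.
  apply: dominated_tail => // x.
  have := nbhs_infty_ger x; apply: filterS => n xn.
  by rewrite /= in_itv/= andbT; apply/negP; rewrite -leNgt.
- rewrite /vanishes /F; apply: (@dominated_tail k (fun n => [set` Interval -oo%O (BRight (- n%:R))])) => // x.
  have := nbhs_infty_gtr (- x); apply: filterS => n xn.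
  by rewrite /= in_itv/=; apply/negP; rewrite -ltNge ltrNl.
Qed.

(** The Radon-Nikodym derivative of the Gaussian law agrees almost everywhere with the density, both
    having the same integral over every measurable set. *)
Lemma integral_normal_ge0 (f : R -> R) : measurable_fun setT f -> (forall x, 0 <= f x) ->
  (\int[normal_prob (0:R) 1]_x (f x)%:E = \int[mu]_x (f x * phi x)%:E)%E.
Proof.
move=> mf f0.
have npd := @normal_prob_dominates R 0 1.
have := @Radon_Nikodym_SigmaFinite.change_of_variables _ _ _ (normal_prob 0 1) mu npd
   (EFin \o f) setT.
move=> <-//; last exact/measurable_EFinP.
apply: ae_eq_integral => //.
- apply: emeasurable_funM; first exact/measurable_EFinP.
  exact: (measurable_int _ (Radon_Nikodym_SigmaFinite.f_integrable _)).
- by apply/measurable_EFinP/measurable_funM => //; exact: measurable_normal_pdf.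
have : ae_eq mu setT (Radon_Nikodym_SigmaFinite.f (normal_prob 0 1) mu)
          (EFin \o phi).
  apply: integral_ae_eq => //.
  - exact: Radon_Nikodym_SigmaFinite.f_integrable.
  - by apply/measurable_EFinP; exact: measurable_normal_pdf.
  - by move=> E _ mE; rewrite -Radon_Nikodym_SigmaFinite.f_integral.
by apply: filterS => x H _; rewrite H//= EFinM.
Qed.

(** The nonnegative case applied to |f| gives integrability, after which the change of variables
    holds for signed [f]. *)
Lemma integral_normal (f : R -> R) : measurable_fun setT f -> normal_integrable f ->
  (normal_prob (0:R) 1).-integrable setT (EFin \o f) /\
  (\int[normal_prob (0:R) 1]_x (f x)%:E = (normal_mean f)%:E)%E.
Proof.
move=> mf nf.
have i1 : (normal_prob (0:R) 1).-integrable setT (EFin \o f).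
  apply/integrableP; split; first exact/measurable_EFinP.
  under eq_integral do rewrite /=.
  rewrite integral_normal_ge0//; last exact: measurableT_comp.
  move/integrableP : nf => [_]; apply: le_lt_trans.
  rewrite le_eqVlt; apply/orP; left; apply/eqP; apply: eq_integral => x _ /=.
  by rewrite normrM (ger0_norm (normal_pdf_ge0 _ _ x)).
split=> //.
have npd := @normal_prob_dominates R 0 1.
rewrite -(Radon_Nikodym_change_of_variables npd measurableT i1).
rewrite /normal_mean /Rintegral fineK; last exact: integrable_fin_num.
apply: ae_eq_integral => //.
- apply: emeasurable_funM; first exact/measurable_EFinP.
  have /integrableP[RNm _] : mu.-integrable setT
      (Radon_Nikodym (charge_of_finite_measure (normal_prob 0 1)) mu).
    exact: Radon_Nikodym_integrable.
  exact: RNm.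
- by apply/measurable_EFinP/measurable_funM => //; exact: measurable_normal_pdf.
have : ae_eq mu setT (Radon_Nikodym (charge_of_finite_measure (normal_prob 0 1)) mu)
          (EFin \o phi).
  apply: integral_ae_eq => //.
  - exact: Radon_Nikodym_integrable.
  - by apply/measurable_EFinP; exact: measurable_normal_pdf.
  - by move=> E _ mE; rewrite -Radon_Nikodym_integral.
by apply: filterS => x H _; rewrite H//= EFinM.
Qed.

Section StandardGaussian.
Context d (T : measurableType d) (P : probability T R) (N : {RV P >-> R}).
Hypothesis hN : standard_gaussian_rv N.

Lemma standard_gaussian_expectation h : continuous h -> normal_integrable h ->
  ('E_P[h \o N])%E = (normal_mean h)%:E.
Proof.
move=> ch ih.
have mh : measurable_fun setT h by exact: continuous_measurable_fun.
have [i1 <-] := integral_normal mh ih.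
have mN : measurable_fun setT (N : T -> measurableTypeR R).
  by move=> _ B mB; exact: (@measurable_funP _ _ _ _ setT N measurableT B mB).
(* [normal_prob] lives on [measurableTypeR R], whose display is not the one of [R]. *)
pose N' : {mfun T >-> measurableTypeR R} :=
  HB.pack (N : T -> measurableTypeR R) (isMeasurableFun.Build _ _ T (measurableTypeR R) N mN).
have E1 (g : R -> \bar R) :
    (\int[pushforward P N']_x g x = \int[normal_prob (0:R) 1]_x g x)%E.
  by apply: eq_measure_integral => A mA _; exact: hN.
have mh' : measurable_fun [set: measurableTypeR R] (EFin \o h) by exact/measurable_EFinP.
rewrite unlock -E1 (integral_pushforward mN)//.
apply/integrableP; split.
  by apply/measurable_EFinP; exact: measurableT_comp.
have := @ge0_integral_pushforward _ _ _ _ _ _ mN P setT (fun x => `|(h x)%:E|%E).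
rewrite preimage_setT /comp => <- //; last exact: measurableT_comp.
by rewrite E1; case/integrableP : i1.
Qed.

End StandardGaussian.

End GaussianIntegral.

(** * Ramp functions *)

Section Ramp.
Context {R : realType}.
Implicit Types (h g : R -> R) (x y z s : R).
Local Notation mu := (@lebesgue_measure R).
Local Notation phi := (normal_pdf (0 : R) 1).
Local Notation pk := (normal_peak (1 : R)).

Lemma le_normal_mean h g : normal_integrable h -> normal_integrable g ->
  (forall x, h x <= g x) -> normal_mean h <= normal_mean g.
Proof.
move=> ih ig hg; apply: le_Rintegral => // x _.
by rewrite ler_wpM2r// normal_pdf_ge0.
Qed.

Lemma normal_mean_cst (c : R) : normal_mean (cst c) = c.
Proof.
rewrite /normal_mean RintegralZl//; last exact: integrable_normal_pdf.
by rewrite /Rintegral integral_normal_pdf mulr1.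
Qed.

Lemma normal_meanD h g : normal_integrable h -> normal_integrable g ->
  normal_mean (h \+ g) = normal_mean h + normal_mean g.
Proof.
move=> ih ig; rewrite /normal_mean -RintegralD//.
by apply: eq_Rintegral => x _; rewrite mulrDl.
Qed.

Lemma normal_integrable_bounded h (C : R) : measurable_fun setT h ->
  (forall x, `|h x| <= C) -> normal_integrable h.
Proof.
move=> mh hC; apply: (le_integrable _ _ _ (normal_integrable_cst C)) => //.
  by apply/measurable_EFinP/measurable_funM => //; exact: measurable_normal_pdf.
move=> x _ /=; rewrite lee_fin !normrM ler_wpM2r//.
by rewrite (le_trans (hC x))// ler_norm.
Qed.

Lemma normal_integrable_indic (B : set R) : measurable B -> normal_integrable (\1_B).
Proof.
move=> mB; apply: (@normal_integrable_bounded _ 1); first exact: measurable_indic.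
by move=> x; rewrite indicE; case: (_ \in _); rewrite ?normr1 ?normr0.
Qed.

Lemma normal_integrableD h g : normal_integrable h -> normal_integrable g ->
  normal_integrable (h \+ g).
Proof.
move=> ih ig; have := integrableD measurableT ih ig.
by apply: eq_integrable => // x _ /=; rewrite mulrDl.
Qed.

Lemma normal_mean_itv_le z s : 0 <= s -> normal_mean (\1_`]z, z + s]) <= pk * s.
Proof.
move=> s0; rewrite -lee_fin /normal_mean /Rintegral fineK; last first.
  by apply: integrable_fin_num => //; apply: normal_integrable_indic.
apply: (@le_trans _ _ (\int[mu]_x (pk * \1_`]z, z + s] x)%:E)%E).
  apply: ge0_le_integral => //.
  - by move=> x _; rewrite lee_fin mulr_ge0// normal_pdf_ge0.
  - apply/measurable_EFinP/measurable_funM; last exact: measurable_normal_pdf.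
    exact: measurable_indic.
  - by apply/measurable_EFinP/measurable_funM => //; exact: measurable_indic.
  - by move=> x _; rewrite lee_fin mulrC ler_wpM2r// normal_pdf_ub.
under eq_integral do rewrite EFinM.
rewrite ge0_integralZl//.
- rewrite integral_indic//= setIT lebesgue_measure_itv/= lte_fin.
  case: ifPn => _; last by rewrite mule0 lee_fin mulr_ge0// ltW// normal_peak1_gt0.
  by rewrite -EFinB -EFinM addrC addKr.
- by apply/measurable_EFinP; exact: measurable_indic.
- by rewrite lee_fin ltW// normal_peak1_gt0.
Qed.

(** For [s > 0]: equal to 1 up to [z], to 0 beyond [z + s], and linear in between. It is a
    continuous decreasing substitute for the indicator of ]-oo, z]. *)
Definition ramp z s x : R := Num.max 0 (Num.min 1 (1 - (x - z) / s)).

Lemma ramp01 z s x : 0 <= ramp z s x <= 1.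
Proof. by rewrite /ramp le_max lexx/= ge_max ler01 ge_min lexx. Qed.

Lemma ramp_homo z s : 0 < s -> {homo ramp z s : x y /~ x <= y}.
Proof.
move=> s0 x y xy; rewrite /ramp; apply: le_max2 => //.
by apply: le_min2 => //; rewrite lerB// ler_pM2r ?invr_gt0// lerB.
Qed.

Lemma continuous_ramp z s : continuous (ramp z s).
Proof.
move=> x; apply: (@continuous_max _ R (fun=> 0) (fun x => Num.min 1 (1 - (x - z) / s))).
  exact: cvg_cst.
apply: (@continuous_min _ R (fun=> 1) (fun x => 1 - (x - z) / s)); first exact: cvg_cst.
apply: cvgB; first exact: cvg_cst.
apply: cvgM; last exact: cvg_cst.
by apply: cvgB; [exact: cvg_id|exact: cvg_cst].
Qed.

Lemma normal_integrable_ramp z s : normal_integrable (ramp z s).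
Proof.
apply: (@normal_integrable_bounded _ 1).
  by apply: continuous_measurable_fun; exact: continuous_ramp.
by move=> x; have /andP[? ?] := ramp01 z s x; rewrite ger0_norm.
Qed.

Lemma indic_le_ramp z s x : 0 < s -> \1_`]-oo, z] x <= ramp z s x.
Proof.
move=> s0; rewrite indicE mem_setE in_itv/=; case: (leP x z) => xz /=; last by have /andP[] := ramp01 z s x.
rewrite /ramp le_max; apply/orP; right; rewrite le_min lexx/= lerBrDr gerDl.
by rewrite pmulr_lle0 ?invr_gt0// subr_le0.
Qed.

Lemma ramp_le_indic z s x : 0 < s -> ramp z s x <= \1_`]-oo, z] x + \1_`]z, z + s] x.
Proof.
move=> s0; have /andP[? r1] := ramp01 z s x.
rewrite !indicE !mem_setE !in_itv/=; have [xz|xz] := leP x z => /=; first by rewrite addr0.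
rewrite add0r; have [//|xzs] := leP x (z + s).
rewrite /ramp ge_max lexx/= ge_min; apply/orP; right.
by rewrite subr_le0 ler_pdivlMr// mul1r; lra.
Qed.

Lemma indic_itv_split z s x : 0 < s ->
  \1_`]-oo, z + s] x = \1_`]-oo, z] x + \1_`]z, z + s] x :> R.
Proof.
move=> s0; rewrite !indicE !mem_setE !in_itv/=; have [xz|xz] := leP x z => /=.
  by rewrite addr0 (le_trans xz)// lerDl ltW.
by rewrite add0r.
Qed.

Lemma normal_mean_ramp01 z s : 0 <= normal_mean (ramp z s) <= 1.
Proof.
have ir := normal_integrable_ramp z s.
apply/andP; split; [rewrite -(normal_mean_cst 0)|rewrite -[leRHS](normal_mean_cst 1)];
  by apply: le_normal_mean => //; rewrite ?normal_integrable_cst// => x;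
     have /andP[] := ramp01 z s x.
Qed.

Lemma ramp_lower z s : 0 < s -> normal_mean (\1_`]-oo, z]) <= normal_mean (ramp z s).
Proof.
move=> s0; apply: le_normal_mean => [||x]; last exact: indic_le_ramp.
  exact: normal_integrable_indic.
exact: normal_integrable_ramp.
Qed.

Lemma ramp_upper z s : 0 < s ->
  normal_mean (ramp z s) <= normal_mean (\1_`]-oo, z]) + pk * s.
Proof.
move=> s0; apply: (@le_trans _ _ (normal_mean (\1_`]-oo, z] \+ \1_`]z, z + s]))).
  apply: le_normal_mean => [||x]; last exact: ramp_le_indic.
    exact: normal_integrable_ramp.
  by apply: normal_integrableD; exact: normal_integrable_indic.
rewrite normal_meanD ?lerD2l ?normal_mean_itv_le ?(ltW s0)//; exact: normal_integrable_indic.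
Qed.

Section StandardGaussian.
Context d (T : measurableType d) (P : probability T R) (N : {RV P >-> R}).
Hypothesis hN : standard_gaussian_rv N.

Lemma standard_gaussian_cdf z : cdf N z = (normal_mean (\1_`]-oo, z]))%:E.
Proof.
rewrite /cdf hN; last exact: measurable_itv.
rewrite /normal_prob integral_mkcond /normal_mean /Rintegral fineK; last first.
  by apply: integrable_fin_num => //; apply: normal_integrable_indic.
apply: eq_integral => x _; rewrite patchE indicE; case: ifP; rewrite ?mul1r ?mul0r//.
Qed.

End StandardGaussian.
End Ramp.

(** * Harmonic sums over primes *)

Section HarmonicSums.
Context {R : realType}.
Implicit Types (n m p k : nat).

(** The upper end is excluded: [harm n] stops at [n - 1], which suits the comparison with [ln n] and
    the cutting into blocks of equal length. *)
Definition harm n : R := \sum_(1 <= k < n) k%:R^-1.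

Lemma harm_L n : harm n.+1 = L_ n.
Proof. by []. Qed.

Lemma harmS n : (0 < n)%N -> harm n.+1 = harm n + n%:R^-1.
Proof. by move=> n0; rewrite /harm big_nat_recr. Qed.

Lemma harm_le n m : (n <= m)%N -> harm n <= harm m.
Proof.
move=> /subnKC <-; elim: (m - n)%N => [|j IH]; first by rewrite addn0.
rewrite addnS (le_trans IH)//; case: (n + j)%N => [|i]; first by rewrite /harm !big_geq.
by rewrite (@harmS i.+1)// lerDl invr_ge0.
Qed.

Lemma harm_ge0 n : 0 <= harm n.
Proof. by apply: sumr_ge0 => k _; rewrite invr_ge0. Qed.

Lemma ln_le_harm n : (0 < n)%N -> ln n%:R <= harm n.
Proof.
elim: n => // -[|n] IH _; first by rewrite ln1 harm_ge0.
rewrite harmS//.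
have n1 : 0 < n.+1%:R :> R by rewrite ltr0n.
have -> : n.+2%:R = n.+1%:R * (1 + n.+1%:R^-1) :> R.
  by rewrite mulrDr mulr1 mulfV ?gt_eqF// -natr1.
rewrite lnM ?posrE//.
apply: lerD; first exact: IH.
by apply: le_ln1Dx; rewrite (lt_le_trans _ (_ : 0 <= _))// invr_ge0 ltW.
Qed.

(** By induction: 1/(n + 1) <= 2/(n + 2), and ln(n + 2) - ln(n + 1) >= 1/(n + 2). *)
Lemma harm_le_ln n : (0 < n)%N -> harm n <= 2 * ln n%:R.
Proof.
elim: n => // -[|n] IH _; first by rewrite ln1 mulr0 /harm big_geq.
rewrite harmS//.
have n1 : 0 < n.+1%:R :> R by rewrite ltr0n.
have n2 : 0 < n.+2%:R :> R by rewrite ltr0n.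
have E : n.+1%:R = n.+2%:R * (1 - n.+2%:R^-1) :> R.
  by rewrite mulrBr mulr1 mulfV ?gt_eqF// -[n.+2]addn1 natrD addrK.
have i0 : 0 < 1 - n.+2%:R^-1 :> R by rewrite subr_gt0 invf_lt1// ltr1n.
have h1 : ln n.+1%:R <= ln n.+2%:R - n.+2%:R^-1 :> R.
  rewrite {1}E lnM ?posrE// lerD2l//.
  by apply: le_ln1Dx; rewrite -subr_gt0 opprK addrC.
have h2 : n.+1%:R^-1 <= 2 * n.+2%:R^-1 :> R.
  rewrite -[X in _ <= X]invrK invfM invrK lef_pV2 ?posrE//.
  by rewrite mulrC ler_pdivrMr// -natrM ler_nat; lia.
by rewrite (le_trans (lerD (IH isT) h2))// -mulrDr ler_pM2l// -lerBrDr.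
Qed.

(** The indices below [p * m] are cut into blocks of length [m]. The first one gives [harm m], and
    the one starting at [j * m] contributes at most [m] times 1/(j m), which is 1/j. *)
Lemma harmM_le p m : (0 < p)%N -> (0 < m)%N -> harm (p * m)%N <= harm m + harm p.
Proof.
move=> + m0; elim: p => // -[|p] IH _; first by rewrite mul1n lerDl harm_ge0.
rewrite mulSn addnC harmS// addrA.
apply: le_trans (lerD (IH isT) (lexx _)).
rewrite /harm (big_cat_nat (n := (p.+1 * m)%N))//=; last 2 first.
- by rewrite muln_gt0.
- by rewrite leq_addr.
rewrite lerD2l.
apply: (@le_trans _ _ (\sum_(p.+1 * m <= k < p.+1 * m + m) (p.+1 * m)%:R^-1)).
  rewrite !big_nat; apply: ler_sum => k /andP[k1 _].
  rewrite lef_pV2 ?posrE ?ler_nat// ltr0n ?muln_gt0 ?m0//.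
  by rewrite (leq_trans _ k1)// muln_gt0.
rewrite big_const_nat addKn -Monoid.iteropE -[X in X <= _]mulr_natr natrM.
by rewrite invfM -mulrA mulVf ?mulr1// pnatr_eq0 -lt0n.
Qed.

Lemma sum_multiples (G : nat -> R) p n : (0 < p)%N ->
  \sum_(1 <= k < n.+1 | (p %| k)%N) G k =
  \sum_(1 <= j < n.+1 | (p * j <= n)%N) G (p * j)%N.
Proof.
move=> p0; rewrite -big_filter -[RHS]big_filter.
rewrite -(big_map (muln p) xpredT G); apply: perm_big.
apply: uniq_perm.
- by rewrite filter_uniq// iota_uniq.
- rewrite map_inj_uniq ?filter_uniq ?iota_uniq// => a b /eqP.
  by rewrite eqn_pmul2l// => /eqP.
- move=> k; rewrite mem_filter mem_index_iota; apply/idP/mapP => [|[j]].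
  + move=> /andP[/dvdnP[j ->] jn]; exists j; last by rewrite mulnC.
    rewrite mem_filter mem_index_iota mulnC; nia.
  + rewrite mem_filter mem_index_iota => /andP[jn j1] ->; rewrite dvdn_mulr//=; nia.
Qed.

(** The sum is [L_ n] minus [harm (n %/ p).+1], and [L_ n] is at most [harm] at the multiple
    [p * (n %/ p).+1], which exceeds [n]. *)
Lemma harm_tail n p : (0 < p)%N ->
  \sum_(1 <= k < n.+1 | (n < p * k)%N) k%:R^-1 <= harm p.
Proof.
move=> p0.
have H : L_ n <= harm (n %/ p).+1 + harm p.
  rewrite -harm_L; apply: le_trans (harmM_le p0 _); last by [].
  by apply: harm_le; rewrite mulnC ltn_ceil.
have E : harm (n %/ p).+1 = \sum_(1 <= k < n.+1 | ~~ (n < p * k)%N) k%:R^-1.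
  rewrite /harm (@big_nat_widen _ _ _ 1 (n %/ p).+1 n.+1)//; last by rewrite ltnS leq_div.
  apply: eq_bigl => k /=; rewrite -leqNgt ltnS leq_divRL// mulnC//.
move: H; rewrite /L_ (bigID (fun k => n < p * k)%N)/= E; lra.
Qed.

End HarmonicSums.

(** * Additive functions over prime powers, and an upper bound of Mertens type *)

Section AdditiveDecomposition.
Context {R : realType}.
Implicit Types (n m p k : nat) (psi : nat -> R).

Lemma additive_arith1 psi : additive_arith psi -> psi 1%N = 0.
Proof.
by move=> /(_ 1%N 1%N isT isT isT); rewrite muln1 => /eqP; rewrite -subr_eq0 opprD addrA subrr sub0r oppr_eq0 => /eqP.
Qed.

Lemma additive_arith_prod psi k m : additive_arith psi ->
  psi (\prod_(1 <= p < m.+1 | prime p) p ^ logn p k)%N =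
  \sum_(1 <= p < m.+1 | prime p) psi (p ^ logn p k)%N.
Proof.
move=> ap; elim: m => [|m IH]; first by rewrite !big_geq// additive_arith1.
rewrite big_mkcond big_nat_recr//= -big_mkcond/=.
rewrite [RHS]big_mkcond big_nat_recr//= -big_mkcond/= -IH.
case: ifPn => pm; last by rewrite muln1 addr0.
rewrite ap// ?expn_gt0 ?prodn_cond_gt0 ?prime_gt0//.
  rewrite coprime_sym coprimeXl// prime_coprime// big_nat_cond.
  apply: (big_ind (fun x => ~~ (m.+1 %| x)%N)) => [|x y Hx Hy|p /andP[/andP[_ pm1] pp]].
  + by rewrite dvdn1; case: m pm {IH} => //.
  + by rewrite Euclid_dvdM// negb_or Hx.
  + apply/negP; rewrite Euclid_dvdX// => /andP[].
    by rewrite dvdn_prime2// => /eqP E; rewrite -E ltnn in pm1.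
Qed.

Lemma prod_prime_powers k m : (0 < k <= m)%N ->
  (\prod_(1 <= p < m.+1 | prime p) p ^ logn p k)%N = k.
Proof.
move=> /andP[k0 km].
have H : (\prod_(0 <= p < m.+1) p ^ logn p k)%N = k.
  rewrite (big_cat_nat (n := k.+1))//= -[RHS]partnT// -[RHS]muln1; congr (_ * _)%N.
  rewrite big_nat big1// => p /andP[kp _].
  by rewrite ltn_log0.
rewrite -[RHS]H [RHS]big_ltn// [logn 0 k]lognE/= expn0 mul1n big_mkcond.
by apply: eq_bigr => p _; case: ifPn => // pp; rewrite lognE (negbTE pp).
Qed.

Lemma additive_arithE psi k m : additive_arith psi -> (0 < k <= m)%N ->
  psi k = \sum_(1 <= p < m.+1 | prime p) psi (p ^ logn p k)%N.
Proof. by move=> ap km; rewrite -additive_arith_prod// prod_prime_powers. Qed.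

Lemma additive_ln : additive_arith (fun k => ln k%:R : R).
Proof. by move=> j k j0 k0 _; rewrite natrM lnM ?posrE ?ltr0n. Qed.

(** The logarithm is itself additive, so ln k is the sum of the logarithms of its prime powers, each
    at least ln p when p divides k. *)
Lemma sum_ln_primes_le n k : (0 < k)%N ->
  \sum_(1 <= p < n.+1 | prime p) (ln p%:R : R) * (p %| k)%N%:R <= ln k%:R.
Proof.
move=> k0.
have lp p : 0 <= (ln p%:R : R).
  by case: p => [|p]; [rewrite ln0|rewrite ln_ge0// ler1n].
rewrite (additive_arithE additive_ln (_ : 0 < k <= maxn k n)%N); last first.
  by rewrite k0 leq_maxl.
rewrite [X in _ <= X](big_cat_nat (n := n.+1))//=; last by rewrite ltnS leq_maxr.
rewrite -[X in X <= _]addr0; apply: lerD; last by apply: sumr_ge0 => p _.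
apply: ler_sum => p pp; have p0 := prime_gt0 pp.
have [pk|] := boolP (p %| k)%N; last by rewrite mulr0.
rewrite mulr1 ler_ln ?posrE ?ltr0n ?expn_gt0 ?p0// ler_nat.
by rewrite -[X in (X <= _)%N]expn1 leq_exp2l ?prime_gt1// logn_gt0 mem_primes pp k0.
Qed.

Definition mertens n : R := \sum_(1 <= p < n.+1 | prime p) ln p%:R / p%:R.

(* Sum [ln k / k] over [k < (n + 1)^2], bounding [ln k] from below by the sum of [ln p] over the primes [p <= n] dividing [k]. *)
Lemma mertens_le n : mertens n <= 4 * ln n.+1%:R.
Proof.
have [->|n0] := posnP n; first by rewrite /mertens big_geq// ln1 mulr0.
set N := (n.+1 * n.+1)%N.
have hN : 0 < harm n.+1 :> R.
  by rewrite (lt_le_trans _ (harm_le (_ : 2 <= n.+1)%N))// /harm big_nat1 invr1.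
have N0 : (0 < N)%N by [].
(* Here ln k <= ln N = 2 ln(n + 1), and [harm N <= 2 * harm n.+1] by cutting into blocks. *)
have up : \sum_(1 <= k < N) ln k%:R / k%:R <= (2 * ln n.+1%:R) * (2 * harm n.+1) :> R.
  apply: (@le_trans _ _ ((2 * ln n.+1%:R) * harm N)).
    rewrite /harm mulr_sumr !big_nat; apply: ler_sum => k /andP[k0 kN].
    rewrite ler_wpM2r// ?invr_ge0//.
    have -> : 2 * ln n.+1%:R = ln N%:R :> R.
      by rewrite /N natrM lnM ?posrE// mulr2n mulrDl mul1r.
    by rewrite ler_ln ?posrE ?ltr0n// ler_nat ltnW.
  rewrite ler_wpM2l// ?mulr_ge0 ?ln_ge0 ?ler1n//.
  by rewrite (le_trans (harmM_le _ _))// mulr2n mulrDl mul1r.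
(* After exchanging the sums, the multiples [p * j] with [p] and [j] at most [n] all lie below [N]
   and already give the product on the left. *)
have low : mertens n * harm n.+1 <= \sum_(1 <= k < N) ln k%:R / k%:R.
  have lp p : 0 <= (ln p%:R : R).
    by case: p => [|p]; [rewrite ln0|rewrite ln_ge0// ler1n].
  apply: (@le_trans _ _ (\sum_(1 <= k < N) (\sum_(1 <= p < n.+1 | prime p) (ln p%:R : R) * (p %| k)%N%:R) / k%:R)); last first.
    rewrite [X in X <= _]big_nat [X in _ <= X]big_nat; apply: ler_sum => k /andP[k0 kN].
    by rewrite ler_wpM2r ?invr_ge0// sum_ln_primes_le.
  under [X in _ <= X]eq_bigr do rewrite mulr_suml.
  rewrite exchange_big/= mulr_suml [X in X <= _]big_nat_cond [X in _ <= X]big_nat_cond.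
  apply: ler_sum => p /andP[/andP[p1 pn] pp]; have p0 := prime_gt0 pp.
  rewrite /harm.
  have -> : \sum_(1 <= k < N) (ln p%:R * (p %| k)%N%:R / k%:R : R) =
      \sum_(1 <= k < N.-1.+1 | (p %| k)%N) (ln p%:R / k%:R).
    rewrite prednK// [RHS]big_mkcond; apply: eq_bigr => k _.
    by case: (p %| k)%N; rewrite ?mulr1// mulr0 mul0r.
  rewrite sum_multiples// mulr_sumr prednK//.
  rewrite (@big_nat_widen _ _ _ 1 n.+1 N)//; last by rewrite /N; nia.
  rewrite [X in X <= _]big_mkcond [X in _ <= X]big_mkcond /=.
  rewrite [X in X <= _]big_nat [X in _ <= X]big_nat; apply: ler_sum => j /andP[j1 jN].
  case: ifPn => [jn|_]; last first.
    by case: ifP => // _; rewrite divr_ge0.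
  have -> : (p * j <= N.-1)%N by rewrite /N; nia.
  by rewrite natrM invfM mulrA.
rewrite -(ler_pM2r hN) (le_trans low)// (le_trans up)//.
rewrite le_eqVlt; apply/orP; left; apply/eqP; ring.
Qed.

Lemma sum_harm_div_le n : \sum_(1 <= p < n.+1 | prime p) harm p / p%:R <= 8 * ln n.+1%:R :> R.
Proof.
apply: (@le_trans _ _ (2 * mertens n)); last by have := mertens_le n; lra.
rewrite /mertens mulr_sumr; apply: ler_sum => p pp.
by rewrite mulrA ler_wpM2r ?invr_ge0// harm_le_ln// prime_gt0.
Qed.

Lemma sum_primes_telescope n :
  \sum_(1 <= p < n.+1 | prime p) (p%:R * (p%:R - 1))^-1 <= 1 :> R.
Proof.
have [->|] := posnP n; first by rewrite big_geq.
(* Strengthened for the induction: over all integers the sum telescopes to 1 - 1/n. *)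
suff H : (0 < n)%N -> \sum_(1 <= p < n.+1 | prime p) (p%:R * (p%:R - 1))^-1 <= 1 - n%:R^-1 :> R.
  by move=> /H /le_trans; apply; rewrite gerBl invr_ge0.
elim: n => // -[|n] IH _; first by rewrite big_mkcond/= big_nat1/= invr1 subrr.
rewrite big_mkcond big_nat_recr//= -big_mkcond/=.
apply: (@le_trans _ _ (1 - n.+1%:R^-1 + (n.+2%:R * (n.+2%:R - 1))^-1)).
  apply: lerD; first exact: IH.
  case: ifP => // _; rewrite invr_ge0 mulr_ge0// subr_ge0 ler1n//.
have -> : n.+2%:R - 1 = n.+1%:R :> R by rewrite -[n.+2]addn1 natrD addrK.
have -> : n.+2%:R = n.+1%:R + 1 :> R by rewrite -[n.+2]addn1 natrD.
have n1 : 0 < n.+1%:R :> R by rewrite ltr0n.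
rewrite le_eqVlt; apply/orP; left; apply/eqP; field.
by rewrite !gt_eqF// addr_gt0.
Qed.

End AdditiveDecomposition.

(** * Harmonic expectation *)

Section HarmonicExpectation.
Context {R : realType}.
Variable n : nat.
Hypothesis n_gt0 : (0 < n)%N.
Implicit Types (g : nat -> R) (p q k : nat).

(** The expectation of g(H) as a finite sum; [harmonic_expectation] identifies it with the
    integral. *)
Definition Eh g : R := (\sum_(1 <= k < n.+1) g k / k%:R) / L_ n.

Lemma L_gt0 : 0 < L_ n :> R.
Proof.
rewrite -harm_L (lt_le_trans _ (harm_le (_ : 2 <= n.+1)%N))//.
by rewrite /harm big_nat1 invr1.
Qed.

Lemma eq_Eh g g' : (forall k, (0 < k <= n)%N -> g k = g' k) -> Eh g = Eh g'.
Proof. by move=> gg; congr (_ / _); rewrite !big_nat; apply: eq_bigr => k kn; rewrite gg. Qed.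

Lemma le_Eh g g' : (forall k, (0 < k <= n)%N -> g k <= g' k) -> Eh g <= Eh g'.
Proof.
move=> gg; rewrite /Eh ler_pM2r ?invr_gt0 ?L_gt0// !big_nat; apply: ler_sum => k kn.
by rewrite ler_wpM2r ?invr_ge0// gg.
Qed.

Lemma EhD g g' : Eh (fun k => g k + g' k) = Eh g + Eh g'.
Proof. by rewrite /Eh -mulrDl -big_split/=; congr (_ / _); apply: eq_bigr => k _; rewrite mulrDl. Qed.

Lemma EhZ c g : Eh (fun k => c * g k) = c * Eh g.
Proof. by rewrite /Eh mulrA mulr_sumr; congr (_ / _); apply: eq_bigr => k _; rewrite mulrA. Qed.

Lemma EhN g : Eh (fun k => - g k) = - Eh g.
Proof. by rewrite -mulN1r -EhZ; apply: eq_Eh => k _; rewrite mulN1r. Qed.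

Lemma EhB g g' : Eh (fun k => g k - g' k) = Eh g - Eh g'.
Proof. by rewrite EhD EhN. Qed.

Lemma Eh_cst c : Eh (fun=> c) = c.
Proof. by rewrite /Eh -mulr_sumr mulfK// gt_eqF// L_gt0. Qed.

Lemma Eh_sum (r : seq nat) (P : pred nat) (F : nat -> nat -> R) :
  Eh (fun k => \sum_(p <- r | P p) F p k) = \sum_(p <- r | P p) Eh (F p).
Proof.
rewrite /Eh -mulr_suml exchange_big/=; congr (_ / _); apply: eq_bigr => k _.
by rewrite mulr_suml.
Qed.

Lemma Eh_norm g : `|Eh g| <= Eh (fun k => `|g k|).
Proof.
rewrite ler_norml -EhN; apply/andP; split; apply: le_Eh => k _.
  by rewrite lerNl -normrN ler_norm.
by rewrite ler_norm.
Qed.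

Lemma Eh_ge0 g : (forall k, (0 < k <= n)%N -> 0 <= g k) -> 0 <= Eh g.
Proof. by move=> g0; rewrite -[0](Eh_cst 0); exact: le_Eh. Qed.

Lemma Eh_norm_le g M : (forall k, (0 < k <= n)%N -> `|g k| <= M) -> `|Eh g| <= M.
Proof. by move=> gM; rewrite (le_trans (Eh_norm g))// -[leRHS]Eh_cst; exact: le_Eh. Qed.

Lemma Eh_dvd d : (0 < d)%N -> Eh (fun k => (d %| k)%N%:R) <= d%:R^-1.
Proof.
move=> d0; rewrite /Eh ler_pdivrMr ?L_gt0//.
have -> : \sum_(1 <= k < n.+1) ((d %| k)%N%:R / k%:R : R) =
    \sum_(1 <= k < n.+1 | (d %| k)%N) k%:R^-1.
  by rewrite [RHS]big_mkcond; apply: eq_bigr => k _; case: ifP; rewrite ?mul1r ?mul0r.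
rewrite sum_multiples// /L_ mulr_sumr big_mkcond; apply: ler_sum => k _.
by case: ifP => _; rewrite ?natrM ?invfM// mulr_ge0 ?invr_ge0.
Qed.

Definition coprimeI p k : R := (~~ (p %| k)%N)%:R.
Definition exactI p k : R := (logn p k == 1)%N%:R.
(** The indicator of overflow: multiplication by [p] leads out of the range 1, ..., n of the
    harmonic law. *)
Definition overI p k : R := (n < p * k)%N%:R.
Local Notation A := coprimeI.
Local Notation X := exactI.
Local Notation O := overI.

Lemma logn_mul_prime p k : prime p -> (0 < k)%N -> logn p (p * k) = (logn p k).+1.
Proof. by move=> pp k0; rewrite lognM ?(prime_gt0 pp)// (logn_prime _ pp) eqxx. Qed.

Lemma logn_mul_neq p q k : prime p -> prime q -> (0 < k)%N -> q != p ->
  logn q (p * k) = logn q k.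
Proof.
by move=> pp pq k0 qp; rewrite lognM ?(prime_gt0 pp)// (logn_prime _ pp) (negbTE qp).
Qed.

Lemma logn_eq0_dvd p k : prime p -> (0 < k)%N -> (logn p k == 0)%N = ~~ (p %| k)%N.
Proof. by move=> pp k0; rewrite eqn0Ngt logn_gt0 mem_primes pp k0. Qed.

Lemma exactI_mul p k : prime p -> (0 < k)%N -> X p (p * k) = A p k.
Proof. by move=> pp k0; rewrite /X /A logn_mul_prime// eqSS logn_eq0_dvd. Qed.

Lemma coprimeI01 p k : 0 <= A p k <= 1.
Proof. by rewrite /A; case: (~~ _); rewrite ?lexx ?ler01. Qed.

Lemma overI01 p k : 0 <= O p k <= 1.
Proof. by rewrite /O; case: (n < _)%N; rewrite ?lexx ?ler01. Qed.

(* [P(H = p k) = P(H = k) / p] as long as [p k <= n]: the Stein identity of the harmonic law. *)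
Lemma Eh_exact p g : prime p ->
  Eh (fun k => X p k * g k) = p%:R^-1 * Eh (fun k => A p k * (1 - O p k) * g (p * k)%N).
Proof.
move=> pp; have p0 := prime_gt0 pp; rewrite /Eh mulrA; congr (_ / _).
transitivity (\sum_(1 <= k < n.+1 | (p %| k)%N) X p k * g k / k%:R).
  rewrite [RHS]big_mkcond !big_nat; apply: eq_bigr => k /andP[k0 _].
  case: ifPn => // pk; have := logn_eq0_dvd pp k0; rewrite pk => /eqP E.
  by rewrite /X E/= !mul0r.
rewrite sum_multiples// mulr_sumr big_mkcond !big_nat; apply: eq_bigr => k /andP[k0 _].
rewrite exactI_mul// /O leqNgt; case: (n < p * k)%N => /=.
  by rewrite subrr mulr0 !mul0r mulr0.
rewrite subr0 mulr1 natrM invfM; ring.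
Qed.

Lemma Eh_over_le p : prime p -> Eh (O p) <= harm p / L_ n.
Proof.
move=> pp; rewrite /Eh ler_pM2r ?invr_gt0 ?L_gt0//.
apply: le_trans (harm_tail n (prime_gt0 pp)).
by rewrite [X in _ <= X]big_mkcond; apply: ler_sum => k _; rewrite /O; case: ifP; rewrite ?mul1r ?mul0r.
Qed.

(** By [harm_tail], P(p H > n) <= [harm p / L_ n]; the Mertens bound sums this to 8 ln(n + 1) / L_n,
    and ln(n + 1) <= L_n. *)
Lemma sum_Eh_over_le : \sum_(1 <= p < n.+1 | prime p) p%:R^-1 * Eh (O p) <= 8.
Proof.
apply: (@le_trans _ _ ((\sum_(1 <= p < n.+1 | prime p) harm p / p%:R) / L_ n)).
  rewrite mulr_suml; apply: ler_sum => p pp.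
  by rewrite mulrAC mulrC ler_wpM2r ?invr_ge0// Eh_over_le.
rewrite ler_pdivrMr ?L_gt0// (le_trans (sum_harm_div_le n))// ler_pM2l//.
by rewrite -harm_L ln_le_harm.
Qed.

Definition overB k : R := \sum_(1 <= p < n.+1 | prime p) p%:R^-1 * O p k.

(** Expanding the square, a pair p <= q is bounded through the overflow at the smaller prime p. The
    sum over p <= q is at most 8 ln(q + 1) / L_n <= 16 ln q / L_n, and the Mertens bound over q
    gives 64, doubled for the two orders of the pair. *)
Lemma Eh_overB_sq : Eh (fun k => overB k ^+ 2) <= 128.
Proof.
pose t p q k : R := (p <= q)%N%:R * (q%:R^-1 * (p%:R^-1 * O p k)).
apply: (@le_trans _ _ (Eh (fun k => 2 * \sum_(1 <= q < n.+1 | prime q) \sum_(1 <= p < n.+1 | prime p) t p q k))).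
  apply: le_Eh => k _.
  have -> : 2 * \sum_(1 <= q < n.+1 | prime q) \sum_(1 <= p < n.+1 | prime p) t p q k =
      \sum_(1 <= q < n.+1 | prime q) \sum_(1 <= p < n.+1 | prime p) (t p q k + t q p k).
    under [RHS]eq_bigr do rewrite big_split/=.
    by rewrite big_split/= [X in _ = _ + X]exchange_big/= mulr2n mulrDl mul1r.
  rewrite expr2 /overB mulr_suml; apply: ler_sum => q pq.
  rewrite mulr_sumr; apply: ler_sum => p pp.
  have q0 : 0 <= q%:R^-1 :> R by rewrite invr_ge0.
  have p0 : 0 <= p%:R^-1 :> R by rewrite invr_ge0.
  have := overI01 p k; have := overI01 q k; rewrite /t => /andP[? ?] /andP[? ?].
  have [pleq|/ltnW qlep] := leqP p q.
    apply: (@le_trans _ _ (q%:R^-1 * (p%:R^-1 * O p k))); last first.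
      by rewrite mul1r lerDl !mulr_ge0.
    rewrite -mulrA ler_wpM2l// ler_piMl// mulr_ge0//.
  rewrite qlep mul1r.
  apply: (@le_trans _ _ (p%:R^-1 * (q%:R^-1 * O q k))); last by rewrite lerDr !mulr_ge0.
  rewrite mulrC -mulrA ler_wpM2l// ler_piMl// mulr_ge0//.
rewrite EhZ Eh_sum.
suff : \sum_(1 <= q < n.+1 | prime q) Eh (fun k => \sum_(1 <= p < n.+1 | prime p) t p q k) <= 64.
  lra.
apply: (@le_trans _ _ (\sum_(1 <= q < n.+1 | prime q) q%:R^-1 * (16 * ln q%:R / L_ n))).
  rewrite big_nat_cond [leRHS]big_nat_cond.
  apply: ler_sum => q /andP[/andP[q1 qn] pq].
  rewrite Eh_sum.
  have -> : \sum_(1 <= p < n.+1 | prime p) Eh (t p q) =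
    q%:R^-1 * \sum_(1 <= p < q.+1 | prime p) p%:R^-1 * Eh (O p).
    rewrite (@big_nat_widen _ _ _ 1 q.+1 n.+1)// mulr_sumr big_mkcondr/=.
    apply: eq_bigr => p pp; rewrite /t ltnS EhZ !EhZ.
    by case: ifP; rewrite ?mul1r ?mul0r.
  rewrite ler_wpM2l ?invr_ge0//.
  apply: (@le_trans _ _ ((\sum_(1 <= p < q.+1 | prime p) harm p / p%:R) / L_ n)).
    rewrite mulr_suml; apply: ler_sum => p pp.
    by rewrite mulrAC mulrC ler_wpM2r ?invr_ge0// Eh_over_le.
  rewrite ler_pM2r ?invr_gt0 ?L_gt0// (le_trans (sum_harm_div_le q))//.
  have q2 := prime_gt1 pq.
  have : ln q.+1%:R <= 2 * ln q%:R :> R.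
    rewrite mulr2n mulrDl !mul1r -lnM ?posrE ?ltr0n// -natrM ler_ln ?posrE ?ltr0n ?muln_gt0 ?q1//.
    by rewrite ler_nat; nia.
  lra.
have -> : \sum_(1 <= q < n.+1 | prime q) q%:R^-1 * (16 * ln q%:R / L_ n) = 16 * mertens n / L_ n :> R.
  by rewrite /mertens mulr_sumr mulr_suml; apply: eq_bigr => q _; ring.
rewrite ler_pdivrMr ?L_gt0//.
have := @mertens_le R n; have := @ln_le_harm R n.+1 isT; rewrite harm_L; lra.
Qed.

End HarmonicExpectation.

(** * Stein's method for the harmonic law *)

Section SteinHarmonic.
Context {R : realType}.
Variable n : nat.
Hypothesis n_gt0 : (0 < n)%N.
Implicit Types (p q k : nat).
Local Notation A := (@coprimeI R).
Local Notation X := (@exactI R).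
Local Notation O := (@overI R n).
Local Notation Eh := (@Eh R n).

(** [pmean] and [pvar] are the mean and the variance of the geometric variable attached to [p];
    [pgap] is the summable excess of the mean over 1/p. *)
Definition pmean p : R := p%:R^-1 * (1 - p%:R^-1)^-1.
Definition pvar p : R := p%:R^-1 * (1 - p%:R^-1) ^- 2.
Definition pgap p : R := (p%:R * (p%:R - 1))^-1.

Lemma prime_ge2R p : prime p -> 2 <= p%:R :> R.
Proof. by move=> /prime_gt1 p1; rewrite ler_nat. Qed.

Lemma pgap_ge0 p : 0 <= pgap p.
Proof.
rewrite /pgap invr_ge0; case: p => [|p]; first by rewrite mul0r.
by rewrite mulr_ge0// subr_ge0 ler1n.
Qed.

Lemma pmeanE p : prime p -> pmean p = p%:R^-1 + pgap p.
Proof.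
by move=> /prime_ge2R; rewrite /pmean /pgap; move: (p%:R) => x x2; field; rewrite !gt_eqF//; lra.
Qed.

Lemma invsq_le_pgap p : prime p -> p%:R^-1 * p%:R^-1 <= pgap p.
Proof.
move=> /prime_ge2R; rewrite /pgap; move: (p%:R) => x x2.
by rewrite -invfM lef_pV2 ?posrE; nra.
Qed.

Lemma pvarE (x : R) : 2 <= x -> x^-1 * (1 - x^-1) ^- 2 = x / (x - 1) ^+ 2.
Proof. by move=> x2; field; rewrite !gt_eqF//; lra. Qed.

Lemma pvar_gap p : prime p -> pvar p - p%:R^-1 + p%:R^-1 * p%:R^-1 <= 4 * pgap p.
Proof.
move=> /prime_ge2R; rewrite /pvar /pgap; move: (p%:R) => x x2; rewrite pvarE//.
have x0 : 0 < x by lra.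
have x1 : 0 < x - 1 by lra.
rewrite -subr_ge0.
have -> : 4 * (x * (x - 1))^-1 - (x / (x - 1) ^+ 2 - x^-1 + x^-1 * x^-1) =
   (x ^+ 2 - x - 1) / (x ^+ 2 * (x - 1) ^+ 2).
  by field; rewrite !gt_eqF.
rewrite divr_ge0 ?mulr_ge0 ?sqr_ge0//; nra.
Qed.

Lemma inv_le_pvar p : prime p -> p%:R^-1 <= pvar p.
Proof.
move=> /prime_ge2R; rewrite /pvar; move: (p%:R) => x x2; rewrite pvarE//.
have x0 : 0 < x by lra.
have x1 : 0 < x - 1 by lra.
rewrite ler_pdivlMr ?exprn_gt0// ler_pdivrMl//; nra.
Qed.

Lemma inv1_le_pvar p : prime p -> p%:R^-1 * (1 + p%:R^-1) <= pvar p.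
Proof.
move=> /prime_ge2R; rewrite /pvar; move: (p%:R) => x x2; rewrite pvarE//.
have x0 : 0 < x by lra.
have x1 : 0 < x - 1 by lra.
have -> : x^-1 * (1 + x^-1) = (x + 1) / x ^+ 2 by field; rewrite gt_eqF.
rewrite ler_pdivlMr ?exprn_gt0// mulrAC ler_pdivrMr ?exprn_gt0//; nra.
Qed.

Lemma Eh_noncoprime_le p : prime p -> Eh (fun k => 1 - A p k) <= p%:R^-1.
Proof.
move=> pp; apply: le_trans (Eh_dvd n_gt0 (prime_gt0 pp)).
apply: le_Eh => // k _; rewrite /A; case: (p %| k)%N => /=; lra.
Qed.

(** The data of the Stein argument: [a p] stands for psi(p)/sigma_n, [W] for the normalized value,
    [Rm] for its part coming from prime powers p^k with k >= 2, and [delta] for c_1/sigma_n. *)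
Variables (a W Rm : nat -> R) (delta : R).
Hypothesis a_le : forall p, prime p -> `|a p| <= delta.
Hypothesis a_var : \sum_(1 <= p < n.+1 | prime p) a p ^+ 2 * pvar p = 1.
Hypothesis WE : forall k, (0 < k <= n)%N ->
  W k = Rm k + \sum_(1 <= p < n.+1 | prime p) a p * (X p k - pmean p).
Hypothesis W_mul : forall p k, prime p -> (0 < k)%N -> ~~ (p %| k)%N ->
  W (p * k)%N = W k + a p.

Lemma delta_ge0 : 0 <= delta.
Proof. exact: le_trans (a_le (isT : prime 2)). Qed.

Lemma Eh_exact_W (g : R -> R) p : prime p ->
  Eh (fun k => X p k * g (W k)) = p%:R^-1 * Eh (fun k => A p k * (1 - O p k) * g (W k + a p)).
Proof.
move=> pp; have /= -> := Eh_exact n (fun k => g (W k)) pp; congr (_ * _).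
apply: eq_Eh => k /andP[k0 _]; rewrite /A; case: (boolP (p %| k)%N) => [pk|pk] /=.
  by rewrite !mul0r.
by rewrite W_mul.
Qed.

Definition stein_main (f : R -> R) : R :=
  \sum_(1 <= p < n.+1 | prime p) a p * (p%:R^-1 * Eh (fun k => A p k * (f (W k + a p) - f (W k)))).

(** Besides [Rm], the errors are the overflow, of total mass at most 8, and the gap between
    [pmean p] and [p%:R^-1 * A p k], of expectation at most [2 * pgap p] and total at most 2; hence
    the 10. *)
Lemma stein_main_le (f : R -> R) M : (forall x, `|f x| <= M) ->
  `|Eh (fun k => W k * f (W k)) - stein_main f| <= M * (Eh (fun k => `|Rm k|) + 10 * delta).
Proof.
move=> fM; have M0 : 0 <= M by exact: le_trans (fM 0).
(* The error for the prime [p]: the overflow lost in the exact identity, then the mismatch of the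
   centering. *)
pose G p k := p%:R^-1 * (A p k * O p k * f (W k + a p)) + (pmean p - p%:R^-1 * A p k) * f (W k).
have -> : Eh (fun k => W k * f (W k)) - stein_main f =
    Eh (fun k => Rm k * f (W k)) - \sum_(1 <= p < n.+1 | prime p) a p * Eh (G p).
  have -> : Eh (fun k => W k * f (W k)) = Eh (fun k => Rm k * f (W k)) +
     \sum_(1 <= p < n.+1 | prime p) a p * (Eh (fun k => X p k * f (W k)) - pmean p * Eh (fun k => f (W k))).
    under [in RHS]eq_bigr do rewrite -EhZ -EhB// -EhZ.
    rewrite -Eh_sum -EhD; apply: eq_Eh => k kn.
    rewrite {1}WE// mulrDl mulr_suml; congr (_ + _); apply: eq_bigr => p _; ring.
  rewrite -addrA; congr (_ + _); rewrite /stein_main -!sumrB -sumrN.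
  apply: eq_bigr => p pp; rewrite Eh_exact_W//.
  rewrite -mulrBr -[RHS]mulrN; congr (_ * _).
  rewrite -!EhZ -!EhB -EhN; apply: eq_Eh => k _; rewrite /G; ring.
rewrite (le_trans (ler_normB _ _))// mulrDr; apply: lerD.
  rewrite (le_trans (Eh_norm _ _))// -EhZ; apply: le_Eh => // k _.
  by rewrite normrM mulrC ler_wpM2r.
rewrite (le_trans (ler_norm_sum _ _ _))//.
apply: (@le_trans _ _ (\sum_(1 <= p < n.+1 | prime p) delta * (M * (p%:R^-1 * Eh (O p) + 2 * pgap p)))).
  apply: ler_sum => p pp; rewrite normrM ler_pM// ?a_le//.
  have pm := pmeanE pp; have g0 := pgap_ge0 p; have p2 := prime_ge2R pp.
  have p0 : 0 <= p%:R^-1 :> R by rewrite invr_ge0.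
  apply: (@le_trans _ _ (Eh (fun k => M * (p%:R^-1 * O p k + (pgap p + p%:R^-1 * (1 - A p k)))))).
    rewrite (le_trans (Eh_norm _ _))//; apply: le_Eh => // k _.
    rewrite /G (le_trans (ler_normD _ _))// mulrDr; apply: lerD.
      rewrite normrM (ger0_norm p0) mulrCA ler_wpM2l// normrM mulrC.
      have := @coprimeI01 R p k; have := @overI01 R n p k => /andP[? ?] /andP[? ?].
      rewrite (ger0_norm (_ : 0 <= A p k * O p k)) ?mulr_ge0//.
      apply: ler_pM => //; first by rewrite mulr_ge0.
      by rewrite ler_piMl.
    rewrite normrM mulrC; apply: ler_pM => //.
    have := @coprimeI01 R p k => /andP[? ?].
    rewrite pm ger0_norm; first by rewrite le_eqVlt; apply/orP; left; apply/eqP; ring.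
    have : 0 <= p%:R^-1 * (1 - A p k) by rewrite mulr_ge0// subr_ge0.
    lra.
  rewrite EhZ EhD !EhZ EhD EhZ Eh_cst//; apply: ler_wpM2l => //.
  have := Eh_noncoprime_le pp; have := invsq_le_pgap pp => h1 h2.
  have := ler_wpM2l p0 h2; lra.
rewrite -mulr_sumr -mulr_sumr big_split/= -mulr_sumr.
have := @sum_Eh_over_le R n n_gt0; have := @sum_primes_telescope R n.
rewrite -/(pgap _) => h1 h2.
have h3 : \sum_(1 <= p < n.+1 | prime p) p%:R^-1 * Eh (O p) +
   2 * \sum_(1 <= p < n.+1 | prime p) pgap p <= 10 by rewrite /pgap; lra.
have := ler_wpM2l (mulr_ge0 delta_ge0 M0) h3; lra.
Qed.

Lemma sum_sq_le_var (u : nat -> R) : (forall p, prime p -> u p <= pvar p) ->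
  \sum_(1 <= p < n.+1 | prime p) a p ^+ 2 * u p <= 1.
Proof.
move=> uv; rewrite -[leRHS]a_var; apply: ler_sum => p pp.
by rewrite ler_wpM2l ?sqr_ge0// uv.
Qed.

Definition stein_rem (f f1 : R -> R) : R :=
  \sum_(1 <= p < n.+1 | prime p) a p * (p%:R^-1 *
     Eh (fun k => A p k * (f (W k + a p) - f (W k) - a p * f1 (W k)))).

(** The first-order term carries the weights [a p ^+ 2 * (p%:R^-1 * A p k)]; replacing them by
    [a p ^+ 2 * pvar p], of sum 1, costs at most [4 * pgap p] in expectation for each prime. *)
Lemma stein_main_rem (f f1 : R -> R) M : (forall x, `|f1 x| <= M) ->
  `|stein_main f - stein_rem f f1 - Eh (fun k => f1 (W k))| <= 4 * M * delta ^+ 2.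
Proof.
move=> fM; have M0 : 0 <= M by exact: le_trans (fM 0).
have -> : stein_main f - stein_rem f f1 - Eh (fun k => f1 (W k)) =
  - \sum_(1 <= p < n.+1 | prime p) a p ^+ 2 * Eh (fun k => (pvar p - p%:R^-1 * A p k) * f1 (W k)).
  rewrite -[X in _ - X]mul1r -[X in _ - X * _]a_var mulr_suml.
  rewrite /stein_main /stein_rem -!sumrB -sumrN; apply: eq_bigr => p pp.
  rewrite -!EhZ -[RHS]EhN -!EhB.
  apply: eq_Eh => k _; ring.
rewrite normrN (le_trans (ler_norm_sum _ _ _))//.
apply: (@le_trans _ _ (\sum_(1 <= p < n.+1 | prime p) delta ^+ 2 * (M * (4 * pgap p)))).
  apply: ler_sum => p pp; rewrite normrM; apply: ler_pM => //.
    rewrite ger0_norm ?sqr_ge0// -(real_normK (num_real (a p))).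
    by rewrite ler_pXn2r ?nnegrE ?delta_ge0// a_le.
  have p0 : 0 <= p%:R^-1 :> R by rewrite invr_ge0.
  apply: (@le_trans _ _ (Eh (fun k => M * (pvar p - p%:R^-1 + p%:R^-1 * (1 - A p k))))).
    rewrite (le_trans (Eh_norm _ _))//; apply: le_Eh => // k _.
    rewrite normrM mulrC; apply: ler_pM => //.
    have := @coprimeI01 R p k => /andP[? ?]; have := inv_le_pvar pp => ?.
    rewrite ger0_norm; first by rewrite le_eqVlt; apply/orP; left; apply/eqP; ring.
    have : p%:R^-1 * A p k <= p%:R^-1 by rewrite ler_piMr.
    lra.
  rewrite EhZ EhD EhZ Eh_cst//; apply: ler_wpM2l => //.
  have := Eh_noncoprime_le pp; have := pvar_gap pp => h1 h2.
  have := ler_wpM2l p0 h2; lra.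
rewrite -mulr_sumr -mulr_sumr -mulr_sumr.
have h1 := @sum_primes_telescope R n.
have := ler_wpM2l (mulr_ge0 (sqr_ge0 delta) M0) h1; rewrite /pgap; lra.
Qed.

(** Each prime contributes at most c |a_p|^3 / p <= c delta a_p^2 / p, and the sum of a_p^2 / p is
    at most 1. *)
Lemma stein_rem_lipschitz (f f1 : R -> R) c : 0 <= c ->
  (forall x s, `|f (x + s) - f x - s * f1 x| <= c * s ^+ 2) ->
  `|stein_rem f f1| <= c * delta.
Proof.
move=> c0 fT; rewrite (le_trans (ler_norm_sum _ _ _))//.
apply: (@le_trans _ _ (c * delta * \sum_(1 <= p < n.+1 | prime p) a p ^+ 2 * p%:R^-1)).
  rewrite mulr_sumr; apply: ler_sum => p pp; rewrite normrM normrM.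
  have p0 : 0 <= p%:R^-1 :> R by rewrite invr_ge0.
  rewrite (ger0_norm p0).
  have E : `|Eh (fun k => A p k * (f (W k + a p) - f (W k) - a p * f1 (W k)))| <= c * a p ^+ 2.
    apply: Eh_norm_le => // k _; rewrite normrM.
    have := @coprimeI01 R p k => /andP[? ?]; rewrite (ger0_norm (_ : 0 <= A p k))//.
    apply: (@le_trans _ _ (1 * (c * a p ^+ 2))); last by rewrite mul1r.
    by apply: ler_pM.
  apply: (@le_trans _ _ (delta * (p%:R^-1 * (c * a p ^+ 2)))).
    by apply: ler_pM; rewrite ?a_le// ?mulr_ge0// ler_wpM2l.
  rewrite le_eqVlt; apply/orP; left; apply/eqP; ring.
rewrite ler_piMr ?mulr_ge0 ?delta_ge0//.
by apply: sum_sq_le_var => p; exact: inv_le_pvar.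
Qed.

(** The product of |a_p|, from the weight of the prime [p], with the signed factor a_p of the
    monotone Taylor bound. *)
Definition bsgn p : R := `|a p| * a p.
(** The weight appearing when the exact identity is read backwards: up to overflow, the sum of b_p
    p^-1 E[A_p (q(W + a_p) - q(W))] is E[- V q(W)], with b_p = [bsgn p]. *)
Definition Vsum k : R :=
  \sum_(1 <= p < n.+1 | prime p) bsgn p * (p%:R^-1 * A p k - X p k).

Lemma bsgn_le p : prime p -> `|bsgn p| <= delta ^+ 2.
Proof.
by move=> pp; rewrite /bsgn normrM normr_id expr2 ler_pM ?a_le.
Qed.

(** Only the term of the prime [p] changes: its [A] drops from 1 to 0 and its [X] rises from 0 to
    1. *)
Lemma Vsum_mul p k : prime p -> (p <= n)%N -> (0 < k)%N -> ~~ (p %| k)%N ->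
  Vsum (p * k)%N = Vsum k - bsgn p * (1 + p%:R^-1).
Proof.
move=> pp pn k0 pk.
suff : Vsum (p * k)%N - Vsum k = - (bsgn p * (1 + p%:R^-1)).
  by move=> <-; rewrite addrC subrK.
have pI : p \in index_iota 1 n.+1 by rewrite mem_index_iota prime_gt0// ltnS.
rewrite /Vsum -sumrB big_mkcond (bigD1_seq p) ?iota_uniq//= pp.
rewrite [X in _ + X]big1_seq ?addr0.
- rewrite (exactI_mul pp k0) /A dvdn_mulr// pk /X.
  have := logn_eq0_dvd pp k0; rewrite pk => /eqP ->; rewrite /=; ring.
- move=> q /andP[qp _]; case: ifP => // pq.
  rewrite /X logn_mul_neq//.
  have -> : A q (p * k)%N = A q k.
    by rewrite /A Euclid_dvdM// dvdn_prime2// (negbTE qp).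
  by rewrite subrr.
Qed.

(** The exact identity is applied to V itself. The increments of V contribute at most delta^2, and
    the overflow at most delta^2 E[B |V|] with B = [overB]. *)
Lemma Eh_Vsum_sq : Eh (fun k => Vsum k ^+ 2) <= 2 * delta ^+ 2 + 128 * delta ^+ 4.
Proof.
have d0 := delta_ge0.
pose G p k := p%:R^-1 * (A p k * (O p k * Vsum k + (1 - O p k) * (bsgn p * (1 + p%:R^-1)))).
have E : Eh (fun k => Vsum k ^+ 2) = \sum_(1 <= p < n.+1 | prime p) bsgn p * Eh (G p).
  transitivity (\sum_(1 <= p < n.+1 | prime p) bsgn p *
      (p%:R^-1 * Eh (fun k => A p k * Vsum k) - Eh (fun k => X p k * Vsum k))).
    under [RHS]eq_bigr do rewrite -EhZ -EhB// -EhZ.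
    rewrite -Eh_sum; apply: eq_Eh => k _; rewrite expr2 {1}/Vsum mulr_suml.
    apply: eq_bigr => p _; ring.
  rewrite big_nat_cond [RHS]big_nat_cond; apply: eq_bigr => p /andP[/andP[p1 pn] pp].
  congr (_ * _); rewrite Eh_exact// -mulrBr -EhB -EhZ; apply: eq_Eh => k /andP[k0 _].
  rewrite /G /A; case: (boolP (p %| k)%N) => pk /=; first by rewrite !mul0r subrr mulr0.
  rewrite Vsum_mul//; ring.
have H : Eh (fun k => Vsum k ^+ 2) <= delta ^+ 2 * Eh (fun k => overB n k * `|Vsum k|) + delta ^+ 2.
  rewrite {1}E (le_trans (ler_norm _))// (le_trans (ler_norm_sum _ _ _))//.
  apply: (@le_trans _ _ (\sum_(1 <= p < n.+1 | prime p)
     (delta ^+ 2 * Eh (fun k => p%:R^-1 * O p k * `|Vsum k|) +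
      delta ^+ 2 * (a p ^+ 2 * (p%:R^-1 * (1 + p%:R^-1)))))).
    apply: ler_sum => p pp.
    have p0 : 0 <= p%:R^-1 :> R by rewrite invr_ge0.
    apply: (@le_trans _ _ (`|bsgn p| * Eh (fun k => p%:R^-1 * O p k * `|Vsum k| +
         p%:R^-1 * (`|bsgn p| * (1 + p%:R^-1))))).
      rewrite normrM ler_wpM2l// (le_trans (Eh_norm _ _))//; apply: le_Eh => // k _.
      rewrite /G normrM (ger0_norm p0) -mulrA -mulrDr ler_wpM2l// normrM.
      have := @coprimeI01 R p k; have := @overI01 R n p k => /andP[? ?] /andP[? ?].
      rewrite (ger0_norm (_ : 0 <= A p k))//.
      rewrite (le_trans (ler_piMl _ _))// (le_trans (ler_normD _ _))//.
      rewrite !normrM (ger0_norm (_ : 0 <= O p k))// lerD2l.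
      rewrite (ger0_norm (_ : 0 <= 1 - O p k)) ?subr_ge0//.
      rewrite (ger0_norm (_ : 0 <= 1 + p%:R^-1)) ?addr_ge0//.
      by rewrite ler_piMl ?mulr_ge0 ?addr_ge0// gerBl.
    rewrite EhD Eh_cst// mulrDr; apply: lerD.
      rewrite ler_wpM2r ?bsgn_le//; apply: Eh_ge0 => // k _.
      by have /andP[? _] := @overI01 R n p k; rewrite !mulr_ge0.
    have -> : `|bsgn p| = a p ^+ 2 by rewrite /bsgn normrM normr_id -expr2 real_normK ?num_real.
    have := bsgn_le pp; rewrite /bsgn normrM normr_id -expr2 real_normK ?num_real// => ad.
    rewrite [X in X <= _](_ : _ = a p ^+ 2 * (a p ^+ 2 * (p%:R^-1 * (1 + p%:R^-1)))); last by ring.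
    have w0 : 0 <= a p ^+ 2 * (p%:R^-1 * (1 + p%:R^-1)).
      by rewrite mulr_ge0 ?sqr_ge0// mulr_ge0// addr_ge0.
    exact: ler_wpM2r.
  rewrite big_split/= -!mulr_sumr; apply: lerD.
    rewrite -Eh_sum ler_wpM2l ?sqr_ge0//; apply: le_Eh => // k _.
    by rewrite /overB mulr_suml.
  rewrite ler_piMr ?sqr_ge0//; apply: sum_sq_le_var => p; exact: inv1_le_pvar.
(* The overflow term is split by the arithmetic-geometric inequality; half of E[V^2] is then
   absorbed by the left-hand side. *)
have H2 : delta ^+ 2 * Eh (fun k => overB n k * `|Vsum k|) <=
    Eh (fun k => Vsum k ^+ 2) / 2 + delta ^+ 4 / 2 * 128.
  apply: (@le_trans _ _ (Eh (fun k => 2^-1 * Vsum k ^+ 2 + delta ^+ 4 / 2 * overB n k ^+ 2))).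
    rewrite -EhZ; apply: le_Eh => // k _.
    rewrite -(real_normK (num_real (Vsum k))).
    have := sqr_ge0 (`|Vsum k| - delta ^+ 2 * overB n k).
    rewrite (_ : delta ^+ 4 = (delta ^+ 2) ^+ 2); last by rewrite -exprM.
    nra.
  rewrite EhD !EhZ [2^-1 * _]mulrC lerD2l ler_wpM2l ?divr_ge0 ?exprn_ge0//.
  exact: Eh_overB_sq.
lra.
Qed.

(** A Cauchy-Schwarz bound in the form |V| <= V^2/(2t) + t/2, where t^2 dominates the second moment
    since 4 >= 2 and 144 >= 128. The case [delta = 0], where t vanishes, is treated apart. *)
Lemma Eh_norm_Vsum : Eh (fun k => `|Vsum k|) <= 2 * delta + 12 * delta ^+ 2.
Proof.
have := delta_ge0; rewrite le_eqVlt => /orP[/eqP d0|d0].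
  rewrite -d0 expr0n/= !mulr0 addr0.
  rewrite (@eq_Eh _ _ _ (fun=> 0)) ?Eh_cst// => k _; rewrite /Vsum big1 ?normr0// => p pp.
  by have := bsgn_le pp; rewrite -d0 expr0n/= normr_le0 => /eqP ->; rewrite mul0r.
set t := 2 * delta + 12 * delta ^+ 2.
have tE : t = 2 * delta + 12 * delta ^+ 2 by [].
have t0 : 0 < t by rewrite tE; nra.
clearbody t.
have : Eh (fun k => `|Vsum k|) <= Eh (fun k => (2 * t)^-1 * Vsum k ^+ 2 + t / 2).
  apply: le_Eh => // k _; rewrite -(real_normK (num_real (Vsum k))).
  have -> : (2 * t)^-1 * `|Vsum k| ^+ 2 + t / 2 = `|Vsum k| + (2 * t)^-1 * (`|Vsum k| - t) ^+ 2.
    by field; rewrite gt_eqF.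
  by rewrite lerDl mulr_ge0 ?sqr_ge0// invr_ge0 mulr_ge0// ltW.
rewrite EhD Eh_cst// EhZ => /le_trans; apply.
rewrite [leRHS]splitr lerD2r.
rewrite ler_pdivrMl; last by rewrite mulr_gt0.
apply: le_trans Eh_Vsum_sq _.
have -> : 2 * t * (t / 2) = t ^+ 2 by field.
have -> : t ^+ 2 = 4 * delta ^+ 2 + 48 * delta ^+ 3 + 144 * delta ^+ 4 by rewrite tE; ring.
have := exprn_gt0 2 d0; have := exprn_gt0 3 d0; have := exprn_gt0 4 d0; lra.
Qed.

(** The Taylor bounds add up to weighted increments of [q], which become E[- V q(W)] plus overflow.
    The first is at most M E|V|, the second at most 8 M delta^2. *)
Lemma stein_rem_monotone (f f1 q : R -> R) M : (forall x, `|q x| <= M) ->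
  (forall x s, `|f (x + s) - f x - s * f1 x| <= s * (q (x + s) - q x)) ->
  `|stein_rem f f1| <= M * (2 * delta + 20 * delta ^+ 2).
Proof.
move=> qM fT; have M0 : 0 <= M by exact: le_trans (qM 0).
have d0 := delta_ge0.
apply: (@le_trans _ _ (\sum_(1 <= p < n.+1 | prime p)
   bsgn p * (p%:R^-1 * Eh (fun k => A p k * (q (W k + a p) - q (W k)))))).
  rewrite (le_trans (ler_norm_sum _ _ _))//; apply: ler_sum => p pp.
  have p0 : 0 <= p%:R^-1 :> R by rewrite invr_ge0.
  rewrite /bsgn normrM -mulrA ler_wpM2l// normrM (ger0_norm p0) mulrCA ler_wpM2l// -EhZ.
  rewrite (le_trans (Eh_norm _ _))//; apply: le_Eh => // k _.
  have := @coprimeI01 R p k => /andP[? ?]; rewrite normrM (ger0_norm (_ : 0 <= A p k))//.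
  by rewrite mulrCA ler_wpM2l.
have -> : \sum_(1 <= p < n.+1 | prime p)
   bsgn p * (p%:R^-1 * Eh (fun k => A p k * (q (W k + a p) - q (W k)))) =
   Eh (fun k => - Vsum k * q (W k)) + \sum_(1 <= p < n.+1 | prime p)
      bsgn p * (p%:R^-1 * Eh (fun k => A p k * O p k * q (W k + a p))).
  have -> : Eh (fun k => - Vsum k * q (W k)) = \sum_(1 <= p < n.+1 | prime p)
      bsgn p * (Eh (fun k => X p k * q (W k)) - p%:R^-1 * Eh (fun k => A p k * q (W k))).
    under [RHS]eq_bigr do rewrite -EhZ -EhB// -EhZ.
    rewrite -Eh_sum; apply: eq_Eh => k _; rewrite /Vsum mulNr mulr_suml -sumrN.
    apply: eq_bigr => p _; ring.
  rewrite -big_split; apply: eq_bigr => p pp /=; rewrite -mulrDr; congr (_ * _).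
  rewrite Eh_exact_W// -mulrBr -mulrDr -EhB -EhD; congr (_ * _).
  apply: eq_Eh => k _; ring.
have -> : M * (2 * delta + 20 * delta ^+ 2) =
  M * (2 * delta + 12 * delta ^+ 2) + delta ^+ 2 * M * 8 by ring.
apply: lerD.
  rewrite (le_trans (ler_norm _))// (le_trans (Eh_norm _ _))//.
  apply: (@le_trans _ _ (Eh (fun k => M * `|Vsum k|))).
    by apply: le_Eh => // k _; rewrite normrM normrN mulrC ler_wpM2r.
  by rewrite EhZ ler_wpM2l// Eh_norm_Vsum.
apply: (@le_trans _ _ (delta ^+ 2 * M * \sum_(1 <= p < n.+1 | prime p) p%:R^-1 * Eh (O p))).
  rewrite mulr_sumr; apply: ler_sum => p pp.
  have p0 : 0 <= p%:R^-1 :> R by rewrite invr_ge0.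
  rewrite (le_trans (ler_norm _))// normrM -mulrA; apply: ler_pM => //; first exact: bsgn_le.
  rewrite normrM (ger0_norm p0) mulrCA ler_wpM2l// -EhZ.
  rewrite (le_trans (Eh_norm _ _))//; apply: le_Eh => // k _.
  have := @coprimeI01 R p k; have := @overI01 R n p k => /andP[? ?] /andP[? ?].
  rewrite normrM ger0_norm ?mulr_ge0// mulrC; apply: ler_pM => //; first by rewrite mulr_ge0.
  by rewrite ler_piMl.
by rewrite ler_wpM2l ?mulr_ge0 ?sqr_ge0// sum_Eh_over_le.
Qed.

(** By the Stein equation the difference is E[f1(W)] - E[W f(W)]. The constants add up as 15 = 10 +
    5 and 12 = 4 * 3. *)
Lemma stein_lipschitz_bound (h f f1 : R -> R) (e : R) :
  (forall x, `|f x| <= 1) -> (forall x, `|f1 x| <= 3) ->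
  (forall x, f1 x = x * f x + (h x - e)) ->
  (forall x s, `|f (x + s) - f x - s * f1 x| <= 5 * s ^+ 2) ->
  `|Eh (fun k => h (W k)) - e| <= Eh (fun k => `|Rm k|) + 15 * delta + 12 * delta ^+ 2.
Proof.
move=> fM f1M f1E fT.
have := stein_main_le fM; have := stein_main_rem f f1M.
have := stein_rem_lipschitz (ler0n R 5) fT.
have -> : Eh (fun k => h (W k)) = Eh (fun k => f1 (W k)) - Eh (fun k => W k * f (W k)) + e.
  by rewrite -EhB -[X in _ = _ + X](Eh_cst n_gt0) -EhD; apply: eq_Eh => k _; rewrite f1E; ring.
rewrite !ler_norml => /andP[? ?] /andP[? ?] /andP[? ?].
by apply/andP; split; lra.
Qed.

(** The same sum of errors: 18 = (4/3) 10 + (7/3) 2 and 56 = (7/3) 20 + 4 (7/3). *)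
Lemma stein_monotone_bound (h f f1 q : R -> R) (e : R) :
  (forall x, `|f x| <= 4 / 3) -> (forall x, `|f1 x| <= 7 / 3) ->
  (forall x, f1 x = x * f x + (h x - e)) -> (forall x, `|q x| <= 7 / 3) ->
  (forall x s, `|f (x + s) - f x - s * f1 x| <= s * (q (x + s) - q x)) ->
  `|Eh (fun k => h (W k)) - e| <=
    4 / 3 * Eh (fun k => `|Rm k|) + 18 * delta + 56 * delta ^+ 2.
Proof.
move=> fM f1M f1E qM fT.
have := stein_main_le fM; have := stein_main_rem f f1M.
have := stein_rem_monotone qM fT.
have -> : Eh (fun k => h (W k)) = Eh (fun k => f1 (W k)) - Eh (fun k => W k * f (W k)) + e.
  by rewrite -EhB -[X in _ = _ + X](Eh_cst n_gt0) -EhD; apply: eq_Eh => k _; rewrite f1E; ring.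
rewrite !ler_norml => /andP[? ?] /andP[? ?] /andP[? ?].
by apply/andP; split; lra.
Qed.

End SteinHarmonic.

(** * Prime powers and random variables *)

Section Remainder.
Context {R : realType}.
Variable n : nat.
Hypothesis n_gt0 : (0 < n)%N.
Implicit Types (psi : nat -> R) (p k : nat).

Definition power_part psi k : R :=
  \sum_(1 <= p < n.+1 | prime p) (2 <= logn p k)%N%:R * psi (p ^ logn p k)%N.

(** An exponent at least 2 is [j + 2] for a single [j]; its indicator is at most that of
    [p ^ (j + 2)] dividing [k], an event of probability at most p^-(j+2). *)
Lemma Eh_power_part_le_sum psi :
  Eh n (fun k => `|power_part psi k|) <=
  \sum_(1 <= p < n.+1 | prime p) \sum_(0 <= j < n) `|psi (p ^ (j + 2))%N| * p%:R^-1 ^+ (j + 2).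
Proof.
apply: (@le_trans _ _ (Eh n (fun k => \sum_(1 <= p < n.+1 | prime p) \sum_(0 <= j < n)
   `|psi (p ^ (j + 2))%N| * (p ^ (j + 2) %| k)%N%:R))).
  apply: le_Eh => // k /andP[k0 kn]; rewrite (le_trans (ler_norm_sum _ _ _))//.
  apply: ler_sum => p pp.
  have [l2|_] := leqP 2 (logn p k); last by rewrite mul0r normr0 sumr_ge0.
  rewrite mul1r.
  have pd : (p ^ logn p k %| k)%N by rewrite pfactor_dvdn.
  (* The exponent is smaller than the prime power, which is at most [k <= n], so [n] terms
     suffice. *)
  have ln : (logn p k - 2 < n)%N.
    have := dvdn_leq k0 pd; have := ltn_expl (logn p k) (prime_gt1 pp); lia.
  rewrite (bigD1_seq (logn p k - 2)%N) ?iota_uniq ?mem_index_iota//=.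
  by rewrite subnK// pd mulr1 lerDl sumr_ge0.
rewrite Eh_sum; apply: ler_sum => p pp.
rewrite Eh_sum; apply: ler_sum => j _.
rewrite EhZ ler_wpM2l// exprVn -natrX; apply: Eh_dvd => //.
by rewrite expn_gt0 prime_gt0.
Qed.

Lemma geometric_sum_le (x : R) m : 0 <= x < 1 -> \sum_(0 <= j < m) x ^+ j <= (1 - x)^-1.
Proof.
move=> /andP[x0 x1]; rewrite -[leRHS]mul1r ler_pdivlMr ?subr_gt0//.
have : (\sum_(0 <= j < m) x ^+ j) * (1 - x) = 1 - x ^+ m.
  elim: m => [|m IH]; first by rewrite big_geq// mul0r expr0 subrr.
  by rewrite big_nat_recr//= mulrDl IH exprS; ring.
by move=> ->; rewrite gerBl exprn_ge0.
Qed.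

(* AM-GM, weighted so that the quadratic term matches the law of the geometric variables. *)
Lemma power_sum_le psi (c s : R) : 0 < s ->
  \sum_(1 <= p < n.+1 | prime p) \sum_(0 <= j < n)
     psi (p ^ (j + 2))%N ^+ 2 * ((1 - p%:R^-1) * p%:R ^- j) * p%:R ^- 2 <= c ->
  \sum_(1 <= p < n.+1 | prime p) \sum_(0 <= j < n) `|psi (p ^ (j + 2))%N| * p%:R^-1 ^+ (j + 2)
    <= c / (2 * s) + s.
Proof.
move=> s0 hc.
set v := (X in X <= c) in hc.
have hv : v / (2 * s) + s * \sum_(1 <= p < n.+1 | prime p) (pgap p : R) <= c / (2 * s) + s.
  apply: lerD; first by rewrite ler_wpM2r// invr_ge0 mulr_ge0// ltW.
  by rewrite ler_piMr ?(ltW s0)//; exact: sum_primes_telescope.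
apply: le_trans hv; rewrite /v mulr_suml mulr_sumr -big_split/=; apply: ler_sum => p pp.
have p2 := @prime_ge2R R p pp.
set x : R := p%:R^-1.
have x0 : 0 < x by rewrite invr_gt0; lra.
have x2 : x <= 1 / 2 by rewrite /x ler_pdivlMr// mulrC ler_pdivrMr; lra.
have x1 : 0 < 1 - x by lra.
apply: (@le_trans _ _ (\sum_(0 <= j < n) (psi (p ^ (j + 2))%N ^+ 2 * ((1 - x) * p%:R ^- j) * p%:R ^- 2 / (2 * s)
   + s / 2 * (x ^+ 2 / (1 - x)) * x ^+ j))).
  apply: ler_sum => j _; rewrite -!exprVn -/x; move: (psi _) => u.
  rewrite -(real_normK (num_real u)) exprD.
  have e0 : 0 < x ^+ j * x ^+ 2 by rewrite mulr_gt0// exprn_gt0.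
  rewrite -subr_ge0.
  have -> : `|u| ^+ 2 * ((1 - x) * x ^+ j) * x ^+ 2 / (2 * s) +
     s / 2 * (x ^+ 2 / (1 - x)) * x ^+ j - `|u| * (x ^+ j * x ^+ 2) =
     (x ^+ j * x ^+ 2) * ((`|u| * (1 - x) - s) ^+ 2 / (2 * s * (1 - x))).
    by field; rewrite !gt_eqF.
  by rewrite mulr_ge0 ?(ltW e0)// divr_ge0 ?sqr_ge0// !mulr_ge0// ltW.
rewrite big_split/= mulr_suml lerD2l -mulr_sumr.
have g := @geometric_sum_le x n; rewrite (ltW x0)/= in g.
have {}g : \sum_(0 <= j < n) x ^+ j <= (1 - x)^-1 by apply: g; lra.
have c0 : 0 <= s / 2 * (x ^+ 2 / (1 - x)).
  by rewrite mulr_ge0 ?divr_ge0 ?sqr_ge0// ltW.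
rewrite (le_trans (ler_wpM2l c0 g))//.
(* The geometric series leaves half of (p - 1)^-2, which is at most [pgap p] because p <= 2 (p -
   1). *)
have -> : s / 2 * (x ^+ 2 / (1 - x)) / (1 - x) = s * ((p%:R - 1) ^- 2 / 2).
  by rewrite /x; field; rewrite !gt_eqF//; lra.
rewrite ler_pM2l// /pgap; move: (p%:R) p2 => y y2.
rewrite -invfM lef_pV2 ?posrE; nra.
Qed.

Lemma Eh_power_part_le psi (c : R) : 0 <= c ->
  \sum_(1 <= p < n.+1 | prime p) \sum_(0 <= j < n)
     psi (p ^ (j + 2))%N ^+ 2 * ((1 - p%:R^-1) * p%:R ^- j) * p%:R ^- 2 <= c ^+ 2 ->
  Eh n (fun k => `|power_part psi k|) <= 2 * c.
Proof.
move=> c0 hc; apply: (@le_trans _ _ (3 / 2 * c)); last lra.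
apply/ler_addgt0Pl => e e0.
(* The choice [s = c] would give 3 c / 2, but [c] may be 0; shifting it by 2 e / 3 adds at most
   [e]. *)
have s0 : 0 < c + 2 / 3 * e by lra.
apply: le_trans (Eh_power_part_le_sum psi) _.
apply: le_trans (power_sum_le s0 hc) _.
have : c ^+ 2 / (2 * (c + 2 / 3 * e)) <= (c + 2 / 3 * e) / 2.
  rewrite ler_pdivrMr; nra.
lra.
Qed.

End Remainder.

(** * Expectations and distribution function of the harmonic variable *)

Section HarmonicVariable.
Context {R : realType} d (T : measurableType d) (P : probability T R).
Variables (H : {RV P >-> nat}) (n : nat).
Hypotheses (n_gt0 : (0 < n)%N) (hH : harmonic_rv H n).

(** The level sets of 1, ..., n are disjoint and of total probability 1, so the integral reduces to
    their union, on each piece of which the integrand is constant. *)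
Lemma harmonic_expectation (g : nat -> R) : ('E_P[g \o H])%E = (Eh n g)%:E.
Proof.
pose F k := H @^-1` [set k].
have mF k : measurable (F k) by rewrite -[F k]setTI; exact: (measurable_funP H).
have tF : trivIset setT F.
  apply/trivIsetP => i j _ _ /eqP ij; apply/seteqP; split=> x // -[Fi Fj].
  have E1 : H x = i := Fi; have E2 : H x = j := Fj.
  by apply: ij; rewrite -E1 -E2.
pose D := \big[setU/set0]_(k <- index_iota 1 n.+1) F k.
have mD : measurable D by apply: bigsetU_measurable.
have mg : measurable_fun setT (EFin \o (g \o H)).
  by apply/measurable_EFinP; apply: measurableT_comp.
have PF k : (0 < k <= n)%N -> P (F k) = ((L_ n * k%:R)^-1)%:E by exact: hH.
have L0 := @L_gt0 R n n_gt0.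
have PD : P D = 1%E.
  have tF' : trivIset setT (fun i => F i.+1).
    by apply/trivIsetP => i j _ _ /= ij; move/trivIsetP : tF; apply.
  rewrite /D big_add1 big_mkord/= (measure_bigsetU P (fun i => mF i.+1) tF' n).
  rewrite -(big_mkord xpredT (fun k => P (F k.+1))) -(big_add1 _ _ 0 n.+1 xpredT (fun k => P (F k))).
  rewrite big_nat (eq_bigr (fun k => ((L_ n * k%:R)^-1)%:E)); last by move=> k kn; exact: PF.
  rewrite -big_nat sumEFin; congr EFin.
  under eq_bigr do rewrite invfM.
  by rewrite -mulr_sumr mulVf// gt_eqF.
have PC : P (~` D) = 0%E by rewrite probability_setC// PD subee.
rewrite unlock.
transitivity (\int[P]_(x in D) (g (H x))%:E)%E.
  rewrite [RHS]integral_mkcond; apply: ae_eq_integral => //.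
  - by apply/(measurable_restrictT _ _).1 => //; exact: measurable_funTS.
  - exists (~` D); split; [exact: measurableC| |].
    + exact: PC.
    + move=> x /= xD Dx; apply: xD => _; by rewrite patchE mem_set.
rewrite integral_bigsetU_EFin//; last 3 first.
- by rewrite iota_uniq.
- exact: sub_trivIset tF.
- exact: measurable_funTS.
rewrite big_nat (eq_bigr (fun k => (g k * (L_ n * k%:R)^-1)%:E)); last first.
  move=> k kn; transitivity (\int[P]_(x in F k) (cst (g k)%:E x))%E.
    by apply: eq_integral => x; rewrite inE => ->.
  by rewrite integral_cst//= PF// EFinM.
rewrite -big_nat sumEFin; congr EFin; rewrite /Eh mulr_suml.
by apply: eq_bigr => k _; rewrite invfM; ring.
Qed.

Lemma harmonic_cdf psi z :
  cdf (normalized_rv psi n H) z = (Eh n (fun k => \1_`]-oo, z] (normalize psi n k)))%:E.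
Proof.
rewrite -harmonic_expectation /cdf /distribution /pushforward.
rewrite -expectation_indic//; last first.
  by rewrite -[X in measurable X]setTI; exact: (measurable_funP (normalized_rv psi n H)).
Qed.

End HarmonicVariable.

(** * Lower bounds for the moments of geometric variables defining c_2 *)

Section GeometricMoments.
Context {R : realType} d (T : measurableType d) (P : probability T R).
Variables (xi : nat -> {RV P >-> nat}) (psi : nat -> R).
Hypothesis hxi : forall p, prime p -> geometric_rv (xi p) p.

(** The integrand is nonnegative and dominates its restriction to the event [xi p < K], whose
    integral is the finite sum. *)
Lemma geometric_moment_ge p K : prime p ->
  ((\sum_(0 <= j < K) psi (p ^ (j + 2))%N ^+ 2 * ((1 - p%:R^-1) * p%:R ^- j))%:E <=
   'E_P[fun w => (psi (p ^ (xi p w + 2))%N ^+ 2)%R])%E.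
Proof.
move=> pp.
pose c j : R := psi (p ^ (j + 2))%N ^+ 2.
have c0 j : 0 <= c j by exact: sqr_ge0.
have mx j : measurable (xi p @^-1` [set j]) by rewrite -[_ @^-1` _]setTI; exact: (measurable_funP (xi p)).
rewrite [in X in (_ <= X)%E]unlock.
apply: (@le_trans _ _ (\int[P]_w (\sum_(j <- index_iota 0 K) (c j * \1_(xi p @^-1` [set j]) w)%:E))%E).
  rewrite ge0_integral_sum//.
  - rewrite -sumEFin; apply: lee_sum => j _.
    under eq_integral do rewrite EFinM.
    rewrite ge0_integralZl//.
    + by rewrite integral_indic//= setIT hxi// -EFinM.
    + by apply/measurable_EFinP; exact: measurable_indic.
    + by rewrite lee_fin.
  - by move=> j; apply/measurable_EFinP/measurable_funM => //; exact: measurable_indic.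
  - by move=> j w _; rewrite lee_fin mulr_ge0.
apply: ge0_le_integral => //.
- by move=> w _; apply: sume_ge0 => j _; rewrite lee_fin mulr_ge0.
- apply: emeasurable_sum => j.
  by apply/measurable_EFinP/measurable_funM => //; exact: measurable_indic.
- by apply/measurable_EFinP; exact: (@measurableT_comp _ _ _ _ _ _ c).
- move=> w _; rewrite sumEFin lee_fin.
  have [wK|wK] := ltnP (xi p w) K.
    rewrite (bigD1_seq (xi p w)) ?iota_uniq ?mem_index_iota//= indicE mem_set//= mulr1.
    rewrite big1 ?addr0// => j jw; rewrite indicE memNset ?mulr0//= => E.
    by rewrite E eqxx in jw.
  rewrite big_nat big1 => [|j /andP[_ jK]]; first exact: c0.
  rewrite indicE memNset ?mulr0//= => E.
  by move: jK; rewrite -E ltnNge wK.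
Qed.

(** Restricting the sum over all primes to those at most [n], and each moment to [K] values, only
    decreases it; finiteness of c_2 makes [fine] faithful. *)
Lemma c2_moment_le n K : (c2 psi xi < +oo)%E ->
  \sum_(1 <= p < n.+1 | prime p) \sum_(0 <= j < K)
     psi (p ^ (j + 2))%N ^+ 2 * ((1 - p%:R^-1) * p%:R ^- j) * p%:R ^- 2 <= fine (c2 psi xi) ^+ 2.
Proof.
rewrite /c2; set E := (\esum_(p in _) _)%E => Eoo.
have E0 : (0 <= E)%E.
  apply: esum_ge0 => p _; rewrite mule_ge0//.
    by apply: expectation_ge0 => w; exact: sqr_ge0.
have : ((\sum_(1 <= p < n.+1 | prime p) \sum_(0 <= j < K)
     psi (p ^ (j + 2))%N ^+ 2 * ((1 - p%:R^-1) * p%:R ^- j) * p%:R ^- 2)%:E <= E)%E.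
  pose r := [seq p <- index_iota 1 n.+1 | prime p].
  apply: esum_ge; exists [set` r].
    split; first exact: finite_seq.
    by move=> p /=; rewrite mem_filter => /andP[].
  rewrite -fsbig_seq ?filter_uniq ?iota_uniq// big_filter -sumEFin.
  apply: lee_sum => p pp; rewrite -mulr_suml EFinM lee_wpmul2r//.
  exact: geometric_moment_ge.
move: E Eoo E0 => [r| |]//= _; rewrite !lee_fin => r0 H.
by rewrite sqr_sqrtr.
Qed.

End GeometricMoments.

(** * Normalization and conclusion *)

Section Normalization.
Context {R : realType}.
Variables (psi : nat -> R) (n : nat).
Hypotheses (psi_add : additive_arith psi) (sigma_gt0 : 0 < sigma_ psi n).
Local Notation a := (fun p => psi p / sigma_ psi n).
Implicit Types (p k : nat).

(** According to the exponent of [p] in [k], the contribution of [p] is psi(1) = 0, psi(p), or a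
    term of [power_part]. *)
Lemma normalizeE k : (0 < k <= n)%N ->
  normalize psi n k = power_part n psi k / sigma_ psi n +
    \sum_(1 <= p < n.+1 | prime p) a p * (exactI p k - pmean p).
Proof.
move=> kn; rewrite /normalize (additive_arithE psi_add kn) /mu_ /power_part.
rewrite -sumrB !mulr_suml -big_split/=; apply: eq_bigr => p pp.
have E : psi (p ^ logn p k)%N = (2 <= logn p k)%N%:R * psi (p ^ logn p k)%N + psi p * exactI p k.
  rewrite /exactI; case: (logn p k) => [|[|l]] /=.
  - by rewrite expn0 additive_arith1// !mul0r mulr0 addr0.
  - by rewrite expn1 mul0r mulr1 add0r.
  - by rewrite mul1r mulr0 addr0.
by rewrite {1}E /pmean; ring.
Qed.

Lemma normalize_mul p k : prime p -> (0 < k)%N -> ~~ (p %| k)%N ->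
  normalize psi n (p * k)%N = normalize psi n k + a p.
Proof.
move=> pp k0 pk; rewrite /normalize.
have -> : psi (p * k)%N = psi p + psi k.
  by apply: psi_add => //; [exact: prime_gt0|rewrite prime_coprime].
by ring.
Qed.

Lemma normalized_variance :
  \sum_(1 <= p < n.+1 | prime p) a p ^+ 2 * pvar p = 1.
Proof.
have s2 : sigma_ psi n ^+ 2 = \sum_(1 <= p < n.+1 | prime p) psi p ^+ 2 * p%:R^-1 * (1 - p%:R^-1) ^- 2.
  rewrite /sigma_ sqr_sqrtr//; apply: sumr_ge0 => p _.
  apply: mulr_ge0; last by rewrite invr_ge0 sqr_ge0.
  by rewrite mulr_ge0 ?sqr_ge0 ?invr_ge0.
have -> : \sum_(1 <= p < n.+1 | prime p) a p ^+ 2 * pvar p = sigma_ psi n ^+ 2 / sigma_ psi n ^+ 2.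
  rewrite {1}s2 mulr_suml; apply: eq_bigr => p _.
  by rewrite /pvar /= expr_div_n; ring.
by rewrite divff// expf_neq0// gt_eqF.
Qed.

Lemma c1_ge p : (c1 psi < +oo)%E -> prime p -> `|psi p| <= fine (c1 psi).
Proof.
move=> c1oo pp; have H : ((`|psi p|)%:E <= c1 psi)%E.
  by apply: ereal_sup_ubound; exists p.
rewrite -lee_fin fineK// fin_numElt c1oo andbT.
by rewrite (lt_le_trans _ H)// ltNyr.
Qed.

End Normalization.

(** * Explicit bounds for Lipschitz functions, ramps and indicators *)

Section SteinBounds.
Context {R : realType}.
Variables (psi : nat -> R) (n : nat) (C1 C2 : R).
Hypotheses (n_gt0 : (0 < n)%N) (psi_add : additive_arith psi)
  (sigma_gt0 : 0 < sigma_ psi n).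
Hypothesis psi_le : forall p, prime p -> `|psi p| <= C1.
Hypothesis power_le : Eh n (fun k => `|power_part n psi k|) <= 2 * C2.
Local Notation s := (sigma_ psi n).
Local Notation W := (normalize psi n).
Local Notation a := (fun p => psi p / s).
Implicit Types (h : R -> R).

Lemma a_le p : prime p -> `|a p| <= C1 / s.
Proof.
by move=> pp; rewrite normrM normfV (gtr0_norm sigma_gt0) ler_pM2r ?invr_gt0// psi_le.
Qed.

Lemma Eh_rem_le : Eh n (fun k => `|power_part n psi k / s|) <= 2 * C2 / s.
Proof.
have -> : Eh n (fun k => `|power_part n psi k / s|) = s^-1 * Eh n (fun k => `|power_part n psi k|).
  rewrite -EhZ; apply: eq_Eh => k _.
  by rewrite normrM normfV (gtr0_norm sigma_gt0) mulrC.
by rewrite mulrC ler_pM2r ?invr_gt0.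
Qed.

Lemma wasserstein_bound h : continuous h -> normal_integrable h ->
  (forall x y, `|h x - h y| <= `|x - y|) ->
  `|Eh n (fun k => h (W k)) - normal_mean h| <= 2 * C2 / s + 15 * (C1 / s) + 12 * (C1 / s) ^+ 2.
Proof.
move=> ch ih hL; have [F [dF F0 F0']] := gauss_primitive_exists ch ih.
have := @stein_lipschitz_bound _ _ n_gt0 a W (fun k => power_part n psi k / s) (C1 / s)
  a_le (normalized_variance sigma_gt0) (normalizeE psi_add) (normalize_mul n psi_add)
  h (stein_sol F) (stein_dsol h (normal_mean h) F) (normal_mean h)
  (stein_sol_lipschitz_le1 dF F0 F0' hL) (stein_dsol_lipschitz_le3 dF F0 F0' hL)
  (fun=> erefl) (stein_taylor_lipschitz dF F0 F0' hL).
by move=> /le_trans; apply; rewrite !lerD2r Eh_rem_le.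
Qed.

(** The right-hand side is free of [t], so the ramp can be made arbitrarily steep. *)
Lemma ramp_bound z t : 0 < t ->
  `|Eh n (fun k => ramp z t (W k)) - normal_mean (ramp z t)| <=
    4 / 3 * (2 * C2 / s) + 18 * (C1 / s) + 56 * (C1 / s) ^+ 2.
Proof.
move=> t0.
have [F [dF F0 F0']] := gauss_primitive_exists (@continuous_ramp R z t) (normal_integrable_ramp z t).
have h01 := ramp01 z t; have e01 := normal_mean_ramp01 z t; have hh := @ramp_homo R z t t0.
have := @stein_monotone_bound _ _ n_gt0 a W (fun k => power_part n psi k / s) (C1 / s)
  a_le (normalized_variance sigma_gt0) (normalizeE psi_add) (normalize_mul n psi_add)
  (ramp z t) (stein_sol F) (stein_dsol (ramp z t) (normal_mean (ramp z t)) F)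
  (stein_monot (ramp z t) F) (normal_mean (ramp z t))
  (stein_sol_monotone_le dF F0 F0' h01 e01) (stein_dsol_monotone_le dF F0 F0' h01 e01)
  (fun=> erefl) (stein_monot_le dF F0 F0' h01 e01) (stein_taylor_monotone dF F0 F0' hh).
by move=> /le_trans; apply; rewrite !lerD2r ler_pM2l// Eh_rem_le.
Qed.

(** The indicator is squeezed between the ramps falling on [z - t, z] and [z, z + t]. The Gaussian
    mass of such an interval is at most the peak of the density times [t], which is the arbitrary
    [e]. *)
Lemma kolmogorov_bound z :
  `|Eh n (fun k => \1_`]-oo, z] (W k)) - normal_mean (\1_`]-oo, z])| <=
    4 / 3 * (2 * C2 / s) + 18 * (C1 / s) + 56 * (C1 / s) ^+ 2.
Proof.
set B := (X in _ <= X); apply/ler_addgt0Pl => e e0.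
have pk0 := @normal_peak1_gt0 R.
pose t := e / normal_peak (1 : R).
have t0 : 0 < t by rewrite divr_gt0.
have tE : normal_peak 1 * t = e by rewrite /t mulrC divfK// gt_eqF.
rewrite ler_norml; apply/andP; split.
- have := ramp_bound (z - t) t0; rewrite -/B ler_norml => /andP[H _].
  have H1 : Eh n (fun k => ramp (z - t) t (W k)) <= Eh n (fun k => \1_`]-oo, z] (W k)).
    apply: le_Eh => // k _; rewrite -[z in leRHS](subrK t) indic_itv_split//.
    exact: ramp_le_indic.
  have H2 : normal_mean (\1_`]-oo, z]) <= normal_mean (\1_`]-oo, z - t]) + e.
    have := normal_mean_itv_le (z - t) (ltW t0); rewrite subrK tE => H2.
    have -> : \1_`]-oo, z] = \1_`]-oo, z - t] \+ \1_`]z - t, z] :> (R -> R).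
      by apply/funext => x; have := indic_itv_split (z - t) x t0; rewrite subrK.
    by rewrite normal_meanD ?lerD2l//; exact: normal_integrable_indic.
  have H3 := ramp_lower (z - t) t0.
  lra.
- have := ramp_bound z t0; rewrite -/B ler_norml => /andP[_ H].
  have H1 : Eh n (fun k => \1_`]-oo, z] (W k)) <= Eh n (fun k => ramp z t (W k)).
    by apply: le_Eh => // k _; exact: indic_le_ramp.
  have H2 := ramp_upper z t0; rewrite tE in H2.
  lra.
Qed.

End SteinBounds.

Lemma lipschitz1_dist (R : realType) (h : R -> R) : 1.-lipschitz h ->
  forall x y, `|h x - h y| <= `|x - y|.
Proof. by move=> hL x y; have := hL (x, y) (conj I I); rewrite /= mul1r. Qed.

Lemma lipschitz1_continuous (R : realType) (h : R -> R) :
  (forall x y, `|h x - h y| <= `|x - y|) -> continuous h.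
Proof.
move=> hL x; apply/cvgrPdist_le => e e0.
near=> y; rewrite (le_trans (hL _ _))//.
Unshelve. all: by end_near. Qed.

Lemma lipschitz1_normal_integrable (R : realType) (h : R -> R) :
  (forall x y, `|h x - h y| <= `|x - y|) -> normal_integrable h.
Proof.
move=> hL; apply: (@normal_integrable_lipschitz _ _ (1 + `|h 0|)).
  exact: lipschitz1_continuous.
move=> x; have := hL x 0; rewrite subr0 => h0.
have : `|h x| <= `|h 0| + `|x|.
  by rewrite -[h x](subrK (h 0)) addrC (le_trans (ler_normD _ _))// lerD2l.
have := normr_ge0 (h 0); have := normr_ge0 x; nra.
Qed.
Theorem theorem2p4 (R : realType)
    (d : measure_display) (T : measurableType d) (P : probability T R)
    (xi : nat -> {RV P >-> nat}) (hxi : indep_geometric_family xi)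
    (psi : nat -> R) (psi_add : additive_arith psi)
    (psi_neq0 : exists k : nat, (0 < k)%N /\ psi k != 0)
    (c1_fin : (c1 psi < +oo)%E) (c2_fin : (c2 psi xi < +oo)%E)
    (n : nat) (n_ge27 : (27 <= n)%N)
    (sigma_gt0 : 0 < sigma_ psi n)
    (sigma_ge : 3 * (fine (c1 psi) ^+ 2 + fine (c2 psi xi) ^+ 2)
                <= sigma_ psi n ^+ 2)
    (dH : measure_display) (TH : measurableType dH) (PH : probability TH R)
    (H : {RV PH >-> nat}) (hH : harmonic_rv H n)
    (dN : measure_display) (TN : measurableType dN) (PN : probability TN R)
    (N : {RV PN >-> R}) (hN : standard_gaussian_rv N) :
  let C1 := fine (c1 psi) in
  let C2 := fine (c2 psi xi) in
  let gamma1 := 32 * C1 + 33 * C2 in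
  let gamma2 := 363 * C1 ^+ 2 + 58 * C1 * C2 in
  let gamma3 := 105 * C1 + 2 * C2 in
  (dK (normalized_rv psi n H) N
     <= (gamma1 / sigma_ psi n + gamma2 / sigma_ psi n ^+ 2)%:E)%E /\
  (dW (normalized_rv psi n H) N <= (gamma3 / sigma_ psi n)%:E)%E.

Proof.
move=> C1 C2 gamma1 gamma2 gamma3.
have n_gt0 : (0 < n)%N by exact: leq_trans n_ge27.
have [geo _] := hxi.
have psi_le p : prime p -> `|psi p| <= C1 by exact: c1_ge.
have C1_ge0 : 0 <= C1 by exact: le_trans (psi_le 2%N isT).
have C2_ge0 : 0 <= C2 by rewrite fine_ge0// sqrte_ge0.
have power_le := Eh_power_part_le n_gt0 C2_ge0 (c2_moment_le geo n n c2_fin).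
set s := sigma_ psi n in sigma_gt0 sigma_ge *.
set u := C1 / s; set v := C2 / s.
have u0 : 0 <= u by rewrite divr_ge0// ltW.
have v0 : 0 <= v by rewrite divr_ge0// ltW.
(* This follows from sigma_n^2 >= 3 c_1^2, and it turns the quadratic term of the Wasserstein bound
   into a multiple of [u]. *)
have u1 : u <= 1.
  rewrite ler_pdivrMr// mul1r -(@ler_pXn2r _ 2)// ?nnegrE ?(ltW sigma_gt0)//.
  by apply: le_trans sigma_ge; have := sqr_ge0 C1; have := sqr_ge0 C2; rewrite -/C1 -/C2; lra.
have E2 : 2 * C2 / s = 2 * v by rewrite /v mulrA.
split.
- apply: ge_ereal_sup => _ [z _ <-].
  rewrite (harmonic_cdf n_gt0 hH) (standard_gaussian_cdf hN) -EFinB abse_EFin lee_fin.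
  apply: le_trans (kolmogorov_bound n_gt0 psi_add sigma_gt0 psi_le power_le z) _.
  rewrite E2 -/u.
  have -> : gamma1 / s + gamma2 / s ^+ 2 = 32 * u + 33 * v + 363 * u ^+ 2 + 58 * (u * v).
    by rewrite /gamma1 /gamma2 /u /v; field; rewrite gt_eqF.
  (* Termwise: 18 <= 32 for [u], 8/3 <= 33 for [v], and 56 <= 363 for the square of [u]. *)
  have := mulr_ge0 u0 v0; have := sqr_ge0 u; lra.
- apply: ge_ereal_sup => _ [h /= /lipschitz1_dist hL <-].
  have ch := lipschitz1_continuous hL; have ih := lipschitz1_normal_integrable hL.
  rewrite (standard_gaussian_expectation hN ch ih).
  have -> : ('E_PH[h \o normalized_rv psi n H] = (Eh n (fun k => h (normalize psi n k)))%:E)%E.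
    by rewrite -(harmonic_expectation n_gt0 hH).
  rewrite -EFinB abse_EFin lee_fin.
  apply: le_trans (wasserstein_bound n_gt0 psi_add sigma_gt0 psi_le power_le ch ih hL) _.
  rewrite E2 -/u.
  have -> : gamma3 / s = 105 * u + 2 * v by rewrite /gamma3 /u /v; field; rewrite gt_eqF.
  (* Since [u <= 1], 15 u + 12 u^2 is at most 27 u. *)
  nra.
Qed.
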